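(* Let $\mathbb{X}$ and $\mathbb{Y}$ be metric measure spaces whose measures $\mu_{\mathcal X}$, $\mu_{\mathcal Y}$ are finitely supported, on $\{x_1,\dots,x_m\}$ and $\{y_1,\dots,y_n\}$ respectively, and let $\mathrm{DGW}$ be the optimal value of the associated discrete Gromov-Wasserstein problem with coefficients $L_{ij,kl}$. Let $K:=\max_{i,k\in[m],\,j,l\in[n]}|L_{ij,kl}|$, and let $B$ and $C$ be the constants described in the context. Then for any integer $r\ge 4mn$, the lower bound $\mathrm{lb}(L,\mathcal{T}(\Pi(\mu_{\mathcal X},\mu_{\mathcal Y})))_r$ for $\mathrm{DGW}$ satisfies $$0\le \mathrm{DGW}-\mathrm{lb}(L,\mathcal{T}(\Pi(\mu_{\mathcal X},\mu_{\mathcal Y})))_r\le \frac{C}{r^2}\big(K-\mathrm{DGW}+3\sqrt{mn}\,KB\big)+\frac{C^{1/2}}{r}\,3\sqrt{mn}\,KB.$$ In particular, the hierarchy $\{\mathrm{lb}(L,\mathcal{T}(\Pi(\mu_{\mathcal X},\mu_{\mathcal Y})))_r\}_{r=1}^\infty$ converges to $\mathrm{DGW}$ at the rate $\mathcal{O}(1/r)$.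
   Context: **Discrete Gromov-Wasserstein problem.** $\mathbb{X}=(\mathcal X,d_{\mathcal X},\mu_{\mathcal X})$ and $\mathbb{Y}=(\mathcal Y,d_{\mathcal Y},\mu_{\mathcal Y})$ are metric measure spaces, with $\mu_{\mathcal X}$ supported on $\{x_1,\dots,x_m\}$ and $\mu_{\mathcal Y}$ supported on $\{y_1,\dots,y_n\}$; identify the measures with probability vectors $((\mu_{\mathcal X})_i)_{i\in[m]}$, $((\mu_{\mathcal Y})_j)_{j\in[n]}$. Here $[m]=\{1,\dots,m\}$ and $[m\times n]=[m]\times[n]$. Let $c$ be a real-valued cost function, $L_{ij,kl}=c(d_{\mathcal X}(x_i,x_k),d_{\mathcal Y}(y_j,y_l))$, and $L(\pi)=\sum_{i,k\in[m],\,j,l\in[n]}L_{ij,kl}\pi_{ij}\pi_{kl}$. Let $$r_i(\pi)=\sum_{j}\pi_{ij}-(\mu_{\mathcal X})_i,\qquad c_j(\pi)=\sum_i\pi_{ij}-(\mu_{\mathcal Y})_j,\qquad g(\pi)=1-\sum_{i,j}\pi_{ij},$$ $\Pi(\mu_{\mathcal X},\mu_{\mathcal Y})=\{\pi\in\mathbb{R}^{m\times n}:\pi_{ij}\ge0,\ r_i(\pi)=0,\ c_j(\pi)=0\ \forall i,j\}$, and $\mathrm{DGW}=\min_{\pi\in\Pi(\mu_{\mathcal X},\mu_{\mathcal Y})}L(\pi)$. **SOS lower bound.** Let $\mathbb{R}[\pi]_t$ be the polynomials in the $mn$ variables $\pi_{ij}$ of degree at most $t$, and $\Sigma[\pi]_t$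 the sums of squares of polynomials having degree at most $t$. For $I\subset[m\times n]$ put $e_I=\prod_{(i,j)\in I}\pi_{ij}$. $\mathcal{T}(\Pi(\mu_{\mathcal X},\mu_{\mathcal Y}))_{2r}$ is the set of all polynomials $$\sigma+\sum_{I\subset[m\times n]}e_I\sigma_I+\sum_{i\in[m]}\lambda_i\Big((\mu_{\mathcal X})_i-\sum_{j}\pi_{ij}\Big)+\sum_{j\in[n]}\theta_j\Big((\mu_{\mathcal Y})_j-\sum_{i}\pi_{ij}\Big)$$ with $\sigma\in\Sigma[\pi]_{2r}$, $\sigma_I\in\Sigma[\pi]_{2r-\deg e_I}$ (only $I$ with $\deg e_I\le2r$ contribute), $\lambda_i,\theta_j\in\mathbb{R}[\pi]_{2r-1}$; and $\mathrm{lb}(L,\mathcal{T}(\Pi(\mu_{\mathcal X},\mu_{\mathcal Y})))_r=\sup\{c\in\mathbb{R}: L(\pi)-c\in\mathcal{T}(\Pi(\mu_{\mathcal X},\mu_{\mathcal Y}))_{2r}\}$. **The constant $C$.** For $N\ge1$ let $\Delta_N=\{x\in\mathbb{R}^N:\sum_i x_i\le1,\ x\ge0\}$, with defining polynomials $g_1=x_1,\dots,g_N=x_N$, $g_{N+1}=1-\sum_i x_i$. Let $\mathcal{T}(\Delta_N)_{2r}$ be the set of finite sums $\sum_{I\subset[N+1]}\sigma_I\prod_{i\in I}g_i$ with $\sigma_I$ sums of squares and $\deg(\sigma_I\prod_{i\in I}g_i)\le2r$, and $\mathrm{lb}(f,\mathcal{T}(\Delta_N))_r=\sup\{c\in\mathbb{R}:f-c\in\mathcal{T}(\Delta_N)_{2r}\}$.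 By a known result there is a constant $C_\Delta(N,d)$, depending only on $N$ and $d$, such that for every polynomial $f$ of degree $d$ in $N$ variables and every $r\ge2Nd$, $$f_{\min}-\mathrm{lb}(f,\mathcal{T}(\Delta_N))_r\le\frac{C_\Delta(N,d)}{r^2}(f_{\max}-f_{\min}),$$ where $f_{\min},f_{\max}$ are the minimum and maximum of $f$ on $\Delta_N$. Set $C:=C_\Delta(mn,2)$. **The constant $B$.** Let $h(\pi)=\max_{i\in[m],j\in[n]}\{|g(\pi)|,|r_i(\pi)|,|c_j(\pi)|\}$. $B$ is a constant, depending only on the linear map (hence only on $m,n$) appearing on the left-hand sides of the inequalities $-\pi_{ij}\le0$, $\sum_i\pi_{ij}\le(\mu_{\mathcal Y})_j$, $\sum_j\pi_{ij}\le(\mu_{\mathcal X})_i$, $\sum_{i,j}\pi_{ij}\le1$, $-\sum_{i,j}\pi_{ij}\le-1$ that define $\Pi(\mu_{\mathcal X},\mu_{\mathcal Y})$, such that the Euclidean distance satisfies $d(\pi,\Pi(\mu_{\mathcal X},\mu_{\mathcal Y}))\le B\,h(\pi)$ for all $\pi\in\Delta_{mn}$ (such a constant exists by a known error bound for polyhedra). *)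

(* Defs.v *)
From HB Require Import structures.
From mathcomp Require Import all_boot all_order all_algebra.
(* The notations of mpoly clash with those of mathcomp-analysis. *)
From mathcomp Require Import -(notations) mpoly.
From mathcomp Require Import all_classical all_reals all_analysis.

Set Implicit Arguments.
Unset Strict Implicit.
Unset Printing Implicit Defensive.

Import Order.TTheory GRing.Theory Num.Theory.
Import numFieldNormedType.Exports.

Local Open Scope classical_set_scope.
Local Open Scope ring_scope.

(* The library requires a point on every measurable type; a space carrying a
   probability measure is nonempty, so this loses no generality. *)
#[short(type="pmetricType")]
HB.structure Definition PointedMetric (K : numDomainType) :=
  {M of Metric K M & isPointed M}.

Definition borelType (T : ptopologicalType) := g_sigma_algebraType (@open T).

Record mmSpace (R : realType) := MMSpace {
  mm_space : pmetricType R ;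
  mm_measure : probability (borelType mm_space) R }.

(* Atoms of zero mass are allowed among the [x i]. *)
Definition supported_on (R : realType) (X : mmSpace R) (m : nat)
    (x : 'I_m -> mm_space X) : Prop :=
  injective x /\ mm_measure X (~` range x) = 0%E.

Definition weights (R : realType) (X : mmSpace R) (m : nat)
    (x : 'I_m -> mm_space X) : 'rV[R]_m :=
  \row_i fine (mm_measure X [set x i]).

Definition prob_vec (R : realType) (m : nat) (a : 'rV[R]_m) : Prop :=
  (forall i, 0 <= a 0 i) /\ \sum_i a 0 i = 1.

Section Coupling.
Context (R : realType) (m n : nat) (a : 'rV[R]_m) (b : 'rV[R]_n).
Implicit Types p q : 'M[R]_(m, n).

Definition row_res p (i : 'I_m) : R := \sum_j p i j - a 0 i.
Definition col_res p (j : 'I_n) : R := \sum_i p i j - b 0 j.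
Definition mass_res p : R := 1 - \sum_i \sum_j p i j.

Definition coupling : set 'M[R]_(m, n) :=
  [set p : 'M[R]_(m, n) | [/\ forall i j, 0 <= p i j,
               forall i, row_res p i = 0 &
               forall j, col_res p j = 0]].

Definition residual p : R :=
  Num.max `|mass_res p|
    (Num.max (\big[Num.max/0]_i `|row_res p i|)
             (\big[Num.max/0]_j `|col_res p j|)).

(* The norm of the library on matrices is the sup norm, hence the explicit
   Euclidean distance. *)
Definition dist_coupling p : R :=
  inf [set Num.sqrt (\sum_i \sum_j (p i j - q i j) ^+ 2) | q in coupling].

End Coupling.

(* The same [B] serves all right-hand sides [a], [b]: it depends on the left-hand
   sides of the constraints, i.e. on [m] and [n], only. *)
Definition error_bound_constant (R : realType) (m n : nat) (B : R) : Prop :=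
  forall (a : 'rV[R]_m) (b : 'rV[R]_n), prob_vec a -> prob_vec b ->
  forall p : 'M[R]_(m, n),
    (forall i j, 0 <= p i j) -> \sum_i \sum_j p i j <= 1 ->
    dist_coupling a b p <= B * residual a b p.

Section GromovWasserstein.
Context (R : realType) (m n : nat).
Implicit Types L : 'I_m -> 'I_n -> 'I_m -> 'I_n -> R.

(* [GW_coeff c x y i j k l] is L_{ij,kl}. *)
Definition GW_coeff (X Y : mmSpace R) (c : R -> R -> R)
    (x : 'I_m -> mm_space X) (y : 'I_n -> mm_space Y)
    (i : 'I_m) (j : 'I_n) (k : 'I_m) (l : 'I_n) : R :=
  c (mdist (x i) (x k)) (mdist (y j) (y l)).

Definition GW_obj L (p : 'M[R]_(m, n)) : R :=
  \sum_i \sum_j \sum_k \sum_l L i j k l * p i j * p k l.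

(* The infimum is a minimum: the set of couplings is compact and nonempty. *)
Definition DGW L (a : 'rV[R]_m) (b : 'rV[R]_n) : R :=
  inf [set GW_obj L p | p in coupling a b].

Definition max_coeff L : R :=
  \big[Num.max/0]_i \big[Num.max/0]_j \big[Num.max/0]_k \big[Num.max/0]_l
    `|L i j k l|.

End GromovWasserstein.

Section Polynomials.
Context (R : realType).
Local Notation poly N := (mpoly N R).

(* 1 + deg p, and 0 for the zero polynomial. *)
Definition msize (N : nat) (p : poly N) : nat := mmeasure mdeg p.

Definition pvar (N : nat) (k : 'I_N) : poly N := mpolyX R (mnm1 k).
Definition pcst (N : nat) (c : R) : poly N := mpolyC N c.

Definition deg_le (N : nat) (t : nat) (p : poly N) : Prop :=
  (msize p <= t.+1)%N.
Definition has_deg (N : nat) (t : nat) (p : poly N) : Prop :=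
  msize p = t.+1.

Definition is_sos (N : nat) (p : poly N) : Prop :=
  exists s : seq (poly N), p = \sum_(q <- s) q ^+ 2.

(* An extended real, so that it is -oo when there is no certificate. *)
Definition sos_lb (N : nat) (f : poly N) (T : set (poly N)) : \bar R :=
  ereal_sup [set c%:E | c in [set c | T (f - pcst N c)]].

Section Simplex.
Context (N : nat).

Definition simplex : set ('I_N -> R) :=
  [set v | (forall k, 0 <= v k) /\ \sum_k v k <= 1].

Definition simplex_gen (k : option 'I_N) : poly N :=
  if k is Some k' then pvar k' else 1 - \sum_k' pvar k'.

Definition simplex_preorder (r : nat) : set (poly N) :=
  [set p | exists s : {set option 'I_N} -> poly N,
    (forall I, is_sos (s I) /\
       deg_le (2 * r) (s I * \prod_(k in I) simplex_gen k)) /\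
    p = \sum_I s I * \prod_(k in I) simplex_gen k].

Definition simplex_min (f : poly N) : R :=
  inf [set meval v f | v in simplex].
Definition simplex_max (f : poly N) : R :=
  sup [set meval v f | v in simplex].

Definition simplex_constant (d : nat) (C : R) : Prop :=
  forall f : poly N, has_deg d f -> forall r : nat, (2 * N * d <= r)%N ->
    ((simplex_min f)%:E - sos_lb f (simplex_preorder r) <=
     (C / r%:R ^+ 2 * (simplex_max f - simplex_min f))%:E)%E.

End Simplex.

Section CouplingPreorder.
Context (m n : nat) (a : 'rV[R]_m) (b : 'rV[R]_n).

(* The variable pi_{ij}. *)
Definition pi_var (i : 'I_m) (j : 'I_n) : poly (m * n) :=
  pvar (mxvec_index i j).

Definition GW_poly (L : 'I_m -> 'I_n -> 'I_m -> 'I_n -> R) : poly (m * n) :=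
  \sum_i \sum_j \sum_k \sum_l L i j k l *: (pi_var i j * pi_var k l).

Definition monom (I : {set 'I_m * 'I_n}) : poly (m * n) :=
  \prod_(ij in I) pi_var ij.1 ij.2.

(* [2 * r - #|I|] is used only when it is not truncated; the multipliers
   [lam], [theta] have degree <= 2r - 1, i.e. [msize] <= 2r. *)
Definition coupling_preorder (r : nat) : set (poly (m * n)) :=
  [set p | exists (s0 : poly (m * n))
      (s : {set 'I_m * 'I_n} -> poly (m * n))
      (lam : 'I_m -> poly (m * n)) (theta : 'I_n -> poly (m * n)),
    [/\ is_sos s0 /\ deg_le (2 * r) s0,
        forall I : {set 'I_m * 'I_n}, (#|I| <= 2 * r)%N ->
          is_sos (s I) /\ deg_le (2 * r - #|I|) (s I),
        forall i, (msize (lam i) <= 2 * r)%N,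
        forall j, (msize (theta j) <= 2 * r)%N &
        p = s0 + \sum_(I : {set 'I_m * 'I_n} | (#|I| <= 2 * r)%N) monom I * s I
            + \sum_i lam i * (pcst _ (a 0 i) - \sum_j pi_var i j)
            + \sum_j theta j * (pcst _ (b 0 j) - \sum_i pi_var i j)]].

End CouplingPreorder.

Definition GW_lb (m n : nat) (L : 'I_m -> 'I_n -> 'I_m -> 'I_n -> R)
    (a : 'rV[R]_m) (b : 'rV[R]_n) (r : nat) : \bar R :=
  sos_lb (GW_poly L) (coupling_preorder a b r).

End Polynomials.

(* Main.v *)
Require Import Defs.
From HB Require Import structures.
From mathcomp Require Import all_boot all_order all_algebra.
From mathcomp Require Import -(notations) mpoly.
From mathcomp Require Import all_classical all_reals all_analysis.
From mathcomp Require Import zify ring lra.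
Import Order.TTheory GRing.Theory Num.Theory.
Import numFieldNormedType.Exports.
Local Open Scope classical_set_scope.
Local Open Scope ring_scope.

(**
Write [s] for the mass of [pi], [rho] and [gamma] for its marginals, and [K] for
[max_coeff L]. Let [q] be [m + n] times the sum of the squares of
[rho_i - a_i s] and [gamma_j - b_j s], and put
[F = L + P q + K' (1 - s^2)] with [K' = K + P Q]. As [F - L] lies in the ideal
of the marginal constraints, and this ideal also contains [1 - s], every simplex
certificate for [F - c] is a coupling certificate for [L - c]; hence the known
rate on the simplex, applied to [F], bounds the error for [L].

If [Q s^2] bounds [q] on the simplex then [F <= K'] there. Conversely, moving
[pi] to the marginals [s a] and [s b] changes it by at most [sqrt q] in l1 norm,
so that [L >= s^2 DGW - 2 K s sqrt q] and, by AM-GM, [F >= DGW - e] as soon as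
[K^2 <= P e]. The term [K' (1 - s^2)] makes a deficit of mass harmless.

The constant [B] enters only through [Q = 9/4 m n B^2]. This is admissible
because [B >= 1], and [B^2 >= 2] unless [m = n = 1], as one sees by testing the
error bound at vertices of the simplex. Optimizing [P] and [e] gives the
constant 3.
*)

Set Implicit Arguments.
Unset Strict Implicit.
Unset Printing Implicit Defensive.

(** * Rounding to prescribed marginals *)

Lemma max0_sub (R : realDomainType) (z : R) :
  Num.max 0 z - Num.max 0 (- z) = z.
Proof. by case: (lerP 0 z); case: (lerP 0 (- z)) => ? ?; lra. Qed.

Lemma max0_add (R : realDomainType) (z : R) :
  Num.max 0 z + Num.max 0 (- z) = `|z|.
Proof.
by case: (ger0P z) => ?; case: (lerP 0 z) => ?; case: (lerP 0 (- z)) => ?; lra.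
Qed.

(** Each row in excess is scaled down to its target, and the mass so removed from column [j] is
    dealt back to the deficient rows in proportion to their deficits. Column sums are thereby kept,
    and the l1 change is at most total excess plus total deficit. *)
Lemma fix_row_sums (R : realFieldType) (m n : nat) (p : 'M[R]_(m, n))
    (a : 'I_m -> R) :
  (forall i j, 0 <= p i j) -> (forall i, 0 <= a i) ->
  \sum_i a i = \sum_i \sum_j p i j ->
  exists q : 'M[R]_(m, n),
    [/\ forall i j, 0 <= q i j, forall i, \sum_j q i j = a i,
        forall j, \sum_i q i j = \sum_i p i j &
        \sum_i \sum_j `|q i j - p i j| <= \sum_i `|\sum_j p i j - a i|].
Proof.
move=> p0 a0 eap.
pose rho i := \sum_j p i j.
pose x i := Num.max 0 (rho i - a i); pose y i := Num.max 0 (a i - rho i).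
have x0 i : 0 <= x i by rewrite le_max lexx.
have y0 i : 0 <= y i by rewrite le_max lexx.
have rho0 i : 0 <= rho i by apply: sumr_ge0.
have xy i : x i - y i = rho i - a i.
  by rewrite /x /y -(opprB (rho i)) max0_sub.
have xyn i : x i + y i = `|rho i - a i|.
  by rewrite /x /y -(opprB (rho i)) max0_add.
have exy : \sum_i x i = \sum_i y i.
  apply/eqP; rewrite -subr_eq0 -sumrB (eq_bigr _ (fun i _ => xy i)) sumrB.
  by rewrite eap subrr.
(* [t i] is the fraction removed from row [i]; for an empty row the default [x i / 0 = 0] is the
   right value. *)
pose t i := x i / rho i.
have t0 i : 0 <= t i by rewrite divr_ge0.
have xrho i : x i <= rho i.
  by rewrite ge_max rho0 /=; move: (a0 i); lra.
have rt i : rho i * t i = x i.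
  rewrite /t mulrC; have [r0|r0] := eqVneq (rho i) 0; last by rewrite divfK.
  by rewrite r0 mulr0; apply/eqP; rewrite eq_le x0 -[leRHS]r0 xrho.
have t1 i : t i <= 1.
  rewrite /t; have [->|r0] := eqVneq (rho i) 0; first by rewrite invr0 mulr0.
  by rewrite ler_pdivrMr ?mul1r // lt_def r0 rho0.
pose T := \sum_i y i.
pose v j := \sum_i p i j * t i.
have v0 j : 0 <= v j by apply: sumr_ge0 => i _; rewrite mulr_ge0.
have T0 : 0 <= T by apply: sumr_ge0.
have vT : \sum_j v j = T.
  rewrite /T -exy exchange_big /=; apply: eq_bigr => i _.
  by rewrite -mulr_suml rt.
(* If [T = 0] nothing was removed, every [v j] vanishes, and the default value of the quotient is
   harmless. *)
have TvT j : T * (v j / T) = v j.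
  rewrite mulrC; have [T00|Tn] := eqVneq T 0; last by rewrite divfK.
  rewrite T00 mulr0; apply/esym/eqP; rewrite eq_le v0 andbT -T00 -vT.
  by rewrite (bigD1 j) //= lerDl sumr_ge0.
have yv i : \sum_j y i * (v j / T) = y i.
  rewrite -mulr_sumr -mulr_suml vT.
  have [T00|Tn] := eqVneq T 0; last by rewrite divff // mulr1.
  rewrite T00 mul0r mulr0; apply/esym/eqP; rewrite eq_le y0 andbT -T00 /T.
  by rewrite (bigD1 i) //= lerDl sumr_ge0.
have vT0 j : 0 <= v j / T by rewrite divr_ge0.
exists (\matrix_(i, j) (p i j - p i j * t i + y i * (v j / T))); split.
- move=> i j; rewrite mxE addr_ge0 ?(mulr_ge0 (y0 i) (vT0 j)) //.
  by rewrite subr_ge0 ler_piMr.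
- move=> i; under eq_bigr do rewrite mxE.
  by rewrite big_split /= yv sumrB -mulr_suml -/(rho i) rt; move: (xy i); lra.
- move=> j; under eq_bigr do rewrite mxE.
  rewrite big_split /= -mulr_suml TvT sumrB -/(v j); lra.
rewrite (eq_bigr _ (fun i _ => esym (xyn i))); apply: ler_sum => i _.
rewrite -rt -(yv i) mulr_suml -big_split; apply: ler_sum => j _ /=.
rewrite mxE (_ : _ + _ - _ = y i * (v j / T) - p i j * t i); last by lra.
by rewrite (le_trans (ler_normB _ _)) // addrC !ger0_norm // mulr_ge0.
Qed.

(** Rows first, then columns on the transpose. The first pass keeps column sums, so the cost of the
    second is still read off from [p]; the second keeps the row sums already reached. *)
Lemma round_to_marginals (R : realFieldType) (m n : nat) (p : 'M[R]_(m, n))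
    (a : 'I_m -> R) (b : 'I_n -> R) :
  (forall i j, 0 <= p i j) -> (forall i, 0 <= a i) -> (forall j, 0 <= b j) ->
  \sum_i a i = \sum_i \sum_j p i j -> \sum_j b j = \sum_i \sum_j p i j ->
  exists q : 'M[R]_(m, n),
    [/\ forall i j, 0 <= q i j, forall i, \sum_j q i j = a i,
        forall j, \sum_i q i j = b j &
        \sum_i \sum_j `|q i j - p i j| <=
          \sum_i `|\sum_j p i j - a i| + \sum_j `|\sum_i p i j - b j|].
Proof.
move=> p0 a0 b0 eap ebp.
have [q [q0 qr qc qp]] := fix_row_sums p0 a0 eap.
have qt0 i j : 0 <= q^T i j by rewrite mxE.
have ebq : \sum_j b j = \sum_j \sum_i q^T j i.
  rewrite ebp exchange_big /=; apply: eq_bigr => j _; rewrite -qc.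
  by apply: eq_bigr => i _; rewrite mxE.
have [u [u0 ur uc uq]] := fix_row_sums qt0 b0 ebq.
have qE j : \sum_i q^T j i = \sum_i p i j.
  by rewrite -qc; apply: eq_bigr => i _; rewrite mxE.
exists u^T; split.
- by move=> i j; rewrite mxE.
- move=> i; under eq_bigr do rewrite mxE.
  by rewrite uc -qr; apply: eq_bigr => j _; rewrite mxE.
- by move=> j; under eq_bigr do rewrite mxE; exact: ur.
under [X in _ <= _ + X]eq_bigr do rewrite -qE.
rewrite addrC; apply: le_trans _ (lerD uq qp).
rewrite [X in _ <= X + _]exchange_big -big_split; apply: ler_sum => i _.
rewrite -big_split; apply: ler_sum => j _ /=.
by rewrite !mxE -(subrKA (q i j)) ler_normD.
Qed.

(** * Quadratic forms and sums of squares *)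

Lemma quad_form_le (R : realDomainType) (T : finType) (A : T -> T -> R) (K : R)
    (p : T -> R) :
  (forall u v, `|A u v| <= K) -> (forall u, 0 <= p u) ->
  `|\sum_u \sum_v A u v * p u * p v| <= K * (\sum_u p u) ^+ 2.
Proof.
move=> AK p0; rewrite (le_trans (ler_norm_sum _ _ _)) //.
rewrite expr2 mulr_suml mulr_sumr; apply: ler_sum => u _.
rewrite (le_trans (ler_norm_sum _ _ _)) // mulrA mulr_sumr.
apply: ler_sum => v _; rewrite !normrM !(ger0_norm (p0 _)).
by rewrite !ler_wpM2r.
Qed.

(** Telescoping: [A q q - A p p = A (q - p) q + A p (q - p)], where each untouched factor sums to
    [s]. *)
Lemma quad_form_lipschitz (R : realDomainType) (T : finType) (A : T -> T -> R)
    (K s : R) (p q : T -> R) :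
  (forall u v, `|A u v| <= K) -> (forall u, 0 <= p u) -> (forall u, 0 <= q u) ->
  \sum_u p u = s -> \sum_u q u = s ->
  \sum_u \sum_v A u v * q u * q v - \sum_u \sum_v A u v * p u * p v <=
    2 * K * s * \sum_u `|q u - p u|.
Proof.
move=> AK p0 q0 ps qs; rewrite -sumrB.
have -> : 2 * K * s * (\sum_u `|q u - p u|) =
    \sum_u \sum_v (K * (`|q u - p u| * q v) + K * (p u * `|q v - p v|)).
  under [RHS]eq_bigr do rewrite big_split -!mulr_sumr /=.
  by rewrite big_split /= -!mulr_sumr -!mulr_suml ps qs; ring.
apply: ler_sum => u _; rewrite -sumrB; apply: ler_sum => v _.
have -> : A u v * q u * q v - A u v * p u * p v =
  A u v * (q u - p u) * q v + A u v * p u * (q v - p v) by ring.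
have step c x y : 0 <= x -> `|c| <= K -> c * y * x <= K * (`|y| * x).
  move=> x0 cK; rewrite mulrA ler_wpM2r // (le_trans (ler_norm _)) // normrM.
  by rewrite ler_wpM2r.
rewrite (mulrAC (A u v) (p u)) (mulrC (p u)).
by apply: lerD; rewrite step.
Qed.

(** Cauchy-Schwarz against the constant vector, by summing [2 x y <= x ^ 2 + y ^ 2] over all
    pairs. *)
Lemma sqr_sum_le (R : realFieldType) (T : finType) (x : T -> R) :
  (\sum_u x u) ^+ 2 <= #|T|%:R * \sum_u x u ^+ 2.
Proof.
have -> : #|T|%:R * \sum_u x u ^+ 2 =
    \sum_u \sum_v (x u ^+ 2 / 2 + x v ^+ 2 / 2).
  under [RHS]eq_bigr do rewrite big_split /= sumr_const -mulr_suml.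
  rewrite big_split /= sumr_const sumrMnl -mulr_suml -(mulr_natr (_ / _)).
  by field.
rewrite expr2 mulr_suml; apply: ler_sum => u _.
rewrite mulr_sumr; apply: ler_sum => v _.
by have := sqr_ge0 (x u - x v); rewrite sqrrB; lra.
Qed.

Lemma sqr_sum2_le (R : realFieldType) (m n : nat) (x : 'I_m -> R)
    (y : 'I_n -> R) :
  (\sum_i `|x i| + \sum_j `|y j|) ^+ 2 <=
    (m + n)%:R * (\sum_i x i ^+ 2 + \sum_j y j ^+ 2).
Proof.
pose z (u : 'I_m + 'I_n) := match u with inl i => `|x i| | inr j => `|y j| end.
have sqrN k (f : 'I_k -> R) : \sum_i `|f i| ^+ 2 = \sum_i f i ^+ 2.
  by apply: eq_bigr => i _; rewrite real_normK ?num_real.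
by have := sqr_sum_le z; rewrite !big_sumType /= card_sum !card_ord !sqrN.
Qed.

Lemma sum_sqr_le (R : realDomainType) (I : finType) (x : I -> R) :
  (forall i, 0 <= x i) -> \sum_i x i ^+ 2 <= (\sum_i x i) ^+ 2.
Proof.
move=> x0; rewrite [leRHS]expr2 mulr_suml; apply: ler_sum => i _.
by rewrite expr2 ler_wpM2l // (bigD1 i) //= lerDl sumr_ge0.
Qed.

(** After expansion the cross terms are nonpositive and each remaining sum of squares is at most
    [s ^+ 2]. For [m = 1] the marginal is the mass itself and the residual vanishes; recording this
    matters when [m = n = 1], where [B ^+ 2] may be below 2. *)
Lemma sum_sqr_res_le (R : realFieldType) (m : nat) (rho a : 'I_m -> R) (s : R) :
  (forall i, 0 <= rho i) -> (forall i, 0 <= a i) ->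
  \sum_i a i = 1 -> \sum_i rho i = s ->
  \sum_i (rho i - a i * s) ^+ 2 <= (2 * (1 < m))%:R * s ^+ 2.
Proof.
move=> rho0 a0 a1 rs; have s0 : 0 <= s by rewrite -rs sumr_ge0.
have [m1|m1] := ltnP 1 m; last first.
  rewrite muln0 mul0r big1 // => i _.
  have ei (j : 'I_m) : j = i.
    by apply/val_inj; move: (ltn_ord j) (ltn_ord i) m1 => /=; lia.
  have Ei (f : 'I_m -> R) : \sum_j f j = f i.
    by rewrite (bigD1 i) //= big1 ?addr0 // => j; rewrite (ei j) eqxx.
  by rewrite -rs -(Ei rho) Ei -(Ei a) a1 mul1r subrr expr0n.
rewrite muln1; have h1 := sum_sqr_le rho0; have h2 := sum_sqr_le a0.
have h3 : \sum_i (rho i - a i * s) ^+ 2 <=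
    \sum_i rho i ^+ 2 + (\sum_i a i ^+ 2) * s ^+ 2.
  rewrite mulr_suml -big_split; apply: ler_sum => i _ /=.
  by rewrite sqrrB exprMn lerD2r gerBl mulrn_wge0 // !mulr_ge0.
rewrite rs in h1; rewrite a1 expr1n in h2; apply: le_trans h3 _.
have : (\sum_i a i ^+ 2) * s ^+ 2 <= 1 * s ^+ 2 by rewrite ler_wpM2r ?sqr_ge0.
lra.
Qed.

(** * The Gromov-Wasserstein value and the penalty *)

Section CouplingValue.
Context (R : realType) (m n : nat).
Implicit Types (a : 'rV[R]_m) (b : 'rV[R]_n) (p q : 'M[R]_(m, n)).
Implicit Types L : 'I_m -> 'I_n -> 'I_m -> 'I_n -> R.

Lemma le_max_coeff L i j k l : `|L i j k l| <= max_coeff L.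
Proof.
have le (I : finType) (F : I -> R) u : F u <= \big[Num.max/0]_v F v.
  exact: le_bigmax.
apply: le_trans (le _ (fun i => \big[Num.max/0]_j \big[Num.max/0]_k
  \big[Num.max/0]_l `|L i j k l|) i).
apply: le_trans (le _ (fun j => \big[Num.max/0]_k
  \big[Num.max/0]_l `|L i j k l|) j).
apply: le_trans (le _ (fun k => \big[Num.max/0]_l `|L i j k l|) k).
exact: (le _ (fun l => `|L i j k l|) l).
Qed.

Lemma max_coeff_ge0 L : 0 <= max_coeff L.
Proof. exact: bigmax_ge_id. Qed.

Lemma GW_obj_pair L p :
  GW_obj L p = \sum_(u : 'I_m * 'I_n) \sum_(v : 'I_m * 'I_n)
    L u.1 u.2 v.1 v.2 * p u.1 u.2 * p v.1 v.2.
Proof.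
rewrite /GW_obj pair_big; apply: eq_bigr => u _.
by rewrite pair_big.
Qed.

Lemma norm_GW_obj_le L p : (forall i j, 0 <= p i j) ->
  `|GW_obj L p| <= max_coeff L * (\sum_i \sum_j p i j) ^+ 2.
Proof.
move=> p0; rewrite (pair_big xpredT xpredT (fun i j => p i j)) GW_obj_pair.
by apply: (@quad_form_le _ _ (fun u v => L u.1 u.2 v.1 v.2)) => // u v;
  exact: le_max_coeff.
Qed.

Lemma GW_obj_lipschitz L (s : R) p q :
  (forall i j, 0 <= p i j) -> (forall i j, 0 <= q i j) ->
  \sum_i \sum_j p i j = s -> \sum_i \sum_j q i j = s ->
  GW_obj L q - GW_obj L p <=
    2 * max_coeff L * s * \sum_i \sum_j `|q i j - p i j|.
Proof.
move=> p0 q0; rewrite !(pair_big xpredT xpredT (fun i j => _ i j)) /=.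
rewrite (pair_big xpredT xpredT (fun i j => `|q i j - p i j|)) !GW_obj_pair.
move=> ps qs.
by apply: (@quad_form_lipschitz _ _ (fun u v => L u.1 u.2 v.1 v.2)
  _ _ (fun u => p u.1 u.2) (fun u => q u.1 u.2)) => // u v; exact: le_max_coeff.
Qed.

Lemma GW_objZ L (t : R) p : GW_obj L (t *: p) = t ^+ 2 * GW_obj L p.
Proof.
rewrite !GW_obj_pair mulr_sumr; apply: eq_bigr => u _.
by rewrite mulr_sumr; apply: eq_bigr => v _; rewrite !mxE; ring.
Qed.

Lemma coupling_rowE a b p i : coupling a b p -> \sum_j p i j = a 0 i.
Proof. by move=> [_ /(_ i) /eqP + _]; rewrite subr_eq0 => /eqP. Qed.

Lemma coupling_colE a b p j : coupling a b p -> \sum_i p i j = b 0 j.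
Proof. by move=> [_ _ /(_ j) /eqP]; rewrite subr_eq0 => /eqP. Qed.

Lemma coupling_ge0 a b p i j : coupling a b p -> 0 <= p i j.
Proof. by case. Qed.

Lemma coupling_mass a b p : prob_vec a -> coupling a b p ->
  \sum_i \sum_j p i j = 1.
Proof.
by move=> [_ <-] hp; apply: eq_bigr => i _; exact: coupling_rowE hp.
Qed.

Context (a : 'rV[R]_m) (b : 'rV[R]_n) (ha : prob_vec a) (hb : prob_vec b).

Lemma coupling_nonempty : coupling a b !=set0.
Proof.
exists (\matrix_(i, j) (a 0 i * b 0 j)); split.
- by move=> i j; rewrite mxE mulr_ge0 ?ha.1 ?hb.1.
- move=> i; rewrite /row_res; under eq_bigr do rewrite mxE.
  by rewrite -mulr_sumr hb.2 mulr1 subrr.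
- move=> j; rewrite /col_res; under eq_bigr do rewrite mxE.
  by rewrite -mulr_suml ha.2 mul1r subrr.
Qed.

Lemma DGW_le L p : coupling a b p -> DGW L a b <= GW_obj L p.
Proof.
move=> hp; apply: ge_inf; last by exists p.
exists (- max_coeff L) => _ [q hq <-].
have := norm_GW_obj_le L (fun i j => coupling_ge0 i j hq).
by rewrite (coupling_mass ha hq) expr1n mulr1 ler_norml => /andP[].
Qed.

Lemma le_DGW L (c : R) : (forall p, coupling a b p -> c <= GW_obj L p) ->
  c <= DGW L a b.
Proof.
move=> h; apply: lb_le_inf => [|_ [q hq <-]]; last exact: h.
by have [p hp] := coupling_nonempty; exists (GW_obj L p), p.
Qed.

Lemma DGW_le_max L : DGW L a b <= max_coeff L.
Proof.
have [p hp] := coupling_nonempty; apply: le_trans (DGW_le L hp) _.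
have := norm_GW_obj_le L (fun i j => coupling_ge0 i j hp).
by rewrite (coupling_mass ha hp) expr1n mulr1 ler_norml => /andP[].
Qed.

(** Residuals are taken against [s a] and [s b], with [s] the mass, which makes the penalty
    homogeneous of degree 2. The factor [m + n] is that of Cauchy-Schwarz: the penalty dominates the
    squared l1 residual. *)
Definition penalty p : R := (m + n)%:R *
  (\sum_i (\sum_j p i j - a 0 i * \sum_i \sum_j p i j) ^+ 2 +
   \sum_j (\sum_i p i j - b 0 j * \sum_i \sum_j p i j) ^+ 2).

Lemma penalty_le p : (forall i j, 0 <= p i j) ->
  penalty p <= (2 * (m + n) * ((1 < m) + (1 < n)))%:R *
    (\sum_i \sum_j p i j) ^+ 2.
Proof.
move=> p0.
have hr := @sum_sqr_res_le R m (fun i => \sum_j p i j) (a 0) _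
  (fun i => sumr_ge0 _ (fun j _ => p0 i j)) ha.1 ha.2 erefl.
have hc := @sum_sqr_res_le R n (fun j => \sum_i p i j) (b 0) _
  (fun j => sumr_ge0 _ (fun i _ => p0 i j)) hb.1 hb.2
  (exchange_big _ _ _ _ _ _).
rewrite /penalty mulnAC mulnC natrM -mulrA ler_wpM2l // mulnDr natrD mulrDl.
exact: lerD hr hc.
Qed.

(* Rounding [p] to the marginals [s a], [s b], where [s] is the mass of [p],
   costs at most [2 K s d], where [d ^+ 2 <= penalty p], and
   [2 K s d <= P * d ^+ 2 + e * s ^+ 2] by AM-GM. *)
Lemma GW_obj_penalty_ge L (P e : R) p :
  0 <= P -> 0 <= e -> max_coeff L ^+ 2 <= P * e -> (forall i j, 0 <= p i j) ->
  (DGW L a b - e) * (\sum_i \sum_j p i j) ^+ 2 <= GW_obj L p + P * penalty p.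
Proof.
move=> P0 e0 KPe p0; set K := max_coeff L; set s := \sum_i _.
have s0 : 0 <= s by apply: sumr_ge0 => i _; exact: sumr_ge0.
have [||||q [q0 qr qc qp]] := @round_to_marginals _ _ _ p
  (fun i => a 0 i * s) (fun j => b 0 j * s) p0.
- by move=> i; rewrite mulr_ge0 ?ha.1.
- by move=> j; rewrite mulr_ge0 ?hb.1.
- by rewrite -mulr_suml ha.2 mul1r.
- by rewrite -mulr_suml hb.2 mul1r.
have qs : \sum_i \sum_j q i j = s.
  by under eq_bigr do rewrite qr; rewrite -mulr_suml ha.2 mul1r.
have Dq : DGW L a b * s ^+ 2 <= GW_obj L q.
  (* Without mass no rescaling to a coupling is possible, but then both sides are zero. *)
  have [s00|sn0] := eqVneq s 0.
    have := norm_GW_obj_le L q0; rewrite qs s00 expr0n /= !mulr0.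
    by rewrite normr_le0 => /eqP ->.
  have hq : coupling a b (s^-1 *: q).
    split=> [i j|i|j].
    - by rewrite mxE mulr_ge0 // invr_ge0.
    - rewrite /row_res; under eq_bigr do rewrite mxE.
      by rewrite -mulr_sumr qr mulrCA mulVf // mulr1 subrr.
    - rewrite /col_res; under eq_bigr do rewrite mxE.
      by rewrite -mulr_sumr qc mulrCA mulVf // mulr1 subrr.
  have := DGW_le L hq; rewrite GW_objZ exprVn mulrC ler_pdivlMr //.
  by rewrite exprn_gt0 // lt_def sn0.
have := GW_obj_lipschitz L p0 q0 erefl qs; rewrite -/s -/K.
have := sqr_sum2_le (fun i => \sum_j p i j - a 0 i * s)
  (fun j => \sum_i p i j - b 0 j * s).
rewrite -/(penalty p); set d := (X in X ^+ 2 <= _).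
have d0 : 0 <= d by rewrite addr_ge0 ?sumr_ge0.
have K0 : 0 <= K by exact: max_coeff_ge0.
move=> hd hL.
have {}hL : GW_obj L q - GW_obj L p <= 2 * K * s * d.
  by apply: le_trans hL _; rewrite ler_wpM2l // !mulr_ge0.
have hPd : P * d ^+ 2 <= P * penalty p by rewrite ler_wpM2l.
suff : 2 * K * s * d <= P * d ^+ 2 + e * s ^+ 2 by lra.
(* AM-GM is checked on squares: [(x + y) ^ 2 = (x - y) ^ 2 + 4 x y] with [x = P d ^ 2] and
   [y = e s ^ 2]. *)
rewrite -(@ler_pXn2r _ 2) ?nnegrE ?addr_ge0 ?mulr_ge0 ?sqr_ge0 //.
have h1 : K ^+ 2 * (s * d) ^+ 2 <= P * e * (s * d) ^+ 2.
  by rewrite ler_wpM2r ?sqr_ge0.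
have := sqr_ge0 (P * d ^+ 2 - e * s ^+ 2); move: h1; rewrite !exprMn.
by rewrite sqrrB sqrrD; nra.
Qed.

End CouplingValue.

(** * Lower bounds on the error bound constant *)

Section ErrorBoundConstant.
Context (R : realType).

Lemma le_dist_coupling (m n : nat) (a : 'rV[R]_m) (b : 'rV[R]_n)
    (p : 'M[R]_(m, n)) (d : R) :
  prob_vec a -> prob_vec b ->
  (forall q, coupling a b q -> d ^+ 2 <= \sum_i \sum_j (p i j - q i j) ^+ 2) ->
  d <= dist_coupling a b p.
Proof.
move=> ha hb hd; apply: lb_le_inf.
  by have [q hq] := coupling_nonempty ha hb; exists (Num.sqrt
    (\sum_i \sum_j (p i j - q i j) ^+ 2)), q.
move=> _ [q hq <-]; apply: le_trans (ler_norm _) _.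
by rewrite -sqrtr_sqr ler_wsqrtr // hd.
Qed.

Lemma residual_le (m n : nat) (a : 'rV[R]_m) (b : 'rV[R]_n)
    (p : 'M[R]_(m, n)) (h : R) :
  0 <= h -> `|mass_res p| <= h -> (forall i, `|row_res a p i| <= h) ->
  (forall j, `|col_res b p j| <= h) -> residual a b p <= h.
Proof.
move=> h0 hm hr hc; rewrite /residual !ge_max hm /=.
by apply/andP; split; apply: bigmax_le.
Qed.

Lemma residual_ge0 (m n : nat) (a : 'rV[R]_m) (b : 'rV[R]_n)
    (p : 'M[R]_(m, n)) : 0 <= residual a b p.
Proof. by rewrite /residual le_max normr_ge0. Qed.

Lemma prob_vec_delta (m : nat) (i0 : 'I_m) :
  prob_vec (delta_mx 0 i0 : 'rV[R]_m).
Proof.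
split=> [i|]; first by rewrite mxE; case: (_ && _).
rewrite (bigD1 i0) //= big1 ?addr0 => [|i /negPf ii]; rewrite mxE ?eqxx //.
by rewrite ii.
Qed.

(** The other rows are nonnegative with zero sum, so all mass lies in row [i0]. The coupling is thus
    unique, and distances to it are explicit. *)
Lemma coupling_delta (m n : nat) (i0 : 'I_m) (b : 'rV[R]_n) q j :
  coupling (delta_mx 0 i0) b q -> q i0 j = b 0 j.
Proof.
move=> hq; rewrite -(coupling_colE j hq) (bigD1 i0) //= big1 ?addr0 // => i ii.
have := coupling_rowE i hq; rewrite mxE (negPf ii) andbF => /psumr_eq0P.
by apply=> // k _; exact: coupling_ge0 hq.
Qed.

Lemma error_bound_constant_lower (m n : nat) (B : R) (i0 : 'I_m) (b : 'rV[R]_n)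
    (p : 'M[R]_(m, n)) (d h : R) :
  error_bound_constant m n B -> prob_vec b ->
  (forall i j, 0 <= p i j) -> \sum_i \sum_j p i j <= 1 ->
  0 < d -> d ^+ 2 <= \sum_j (p i0 j - b 0 j) ^+ 2 ->
  residual (delta_mx 0 i0) b p <= h -> d <= B * h.
Proof.
move=> hB hb p0 p1 d0 hd hh; have ha := prob_vec_delta i0.
have hdB : d <= B * residual (delta_mx 0 i0) b p.
  apply: le_trans (hB _ _ ha hb p p0 p1).
  apply: le_dist_coupling => // q hq; apply: le_trans hd _.
  rewrite [leRHS](bigD1 i0) //= -[leLHS]addr0; apply: lerD.
    by apply: ler_sum => j _; rewrite (coupling_delta j hq).
  by do 2!apply: sumr_ge0 => ? _; exact: sqr_ge0.
apply: (le_trans hdB); apply: ler_wpM2l => //.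
(* A negative [B] would make the right-hand side nonpositive, against [0 < d]. *)
rewrite leNgt; apply/negP => B0; move: (lt_le_trans d0 hdB).
by rewrite ltNge nmulr_rle0 // residual_ge0.
Qed.

(** The test point is the zero matrix, with Dirac marginals: its residual is at most 1 and its
    distance to the only coupling at least 1. *)
Lemma error_bound_constant_ge1 (m n : nat) (B : R) :
  (0 < m)%N -> (0 < n)%N -> error_bound_constant m n B -> 1 <= B.
Proof.
move=> m0 n0 hB; have hb := prob_vec_delta (Ordinal n0).
have ha := prob_vec_delta (Ordinal m0).
have mass0 : \sum_(i < m) \sum_(j < n) (0 : 'M[R]_(m, n)) i j = 0.
  by apply: big1 => i _; apply: big1 => j _; rewrite mxE.
rewrite -[B]mulr1; apply: (error_bound_constant_lower hB hb (p := 0)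
  (i0 := Ordinal m0)) => //.
- by move=> i j; rewrite mxE.
- by rewrite mass0.
- rewrite (bigD1 (Ordinal n0)) //= !mxE !eqxx /= sub0r sqrrN lerDl.
  by apply: sumr_ge0 => j _; exact: sqr_ge0.
- apply: residual_le => //.
  + by rewrite /mass_res mass0 subr0 normr1.
  + move=> i; rewrite /row_res big1 => [|j _]; last by rewrite mxE.
    by rewrite sub0r normrN mxE; case: (_ && _); rewrite ?normr1 ?normr0.
  + move=> i; rewrite /col_res big1 => [|j _]; last by rewrite mxE.
    by rewrite sub0r normrN mxE; case: (_ && _); rewrite ?normr1 ?normr0.
Qed.

(** The test point is a unit mass at [(i0, j0)], while the column marginal is split evenly between
    [j0] and [j1]: the squared distance is at least 1/2 for a residual of at most 1/2. *)
Lemma error_bound_constant_sqr_ge2 (m n : nat) (B : R) :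
  (0 < m)%N -> (1 < n)%N -> error_bound_constant m n B -> 2 <= B ^+ 2.
Proof.
move=> m0 n1 hB.
pose i0 := Ordinal m0; pose j0 := Ordinal (ltnW n1); pose j1 := Ordinal n1.
have j10 : j1 != j0 by [].
pose b : 'rV[R]_n := \row_j (((j == j0)%:R + (j == j1)%:R) / 2).
pose p : 'M[R]_(m, n) := delta_mx i0 j0.
have sum1 (k : nat) (l0 : 'I_k) : \sum_l (l == l0)%:R = 1 :> R.
  by rewrite (bigD1 l0) //= eqxx big1 ?addr0 // => l /negPf ->.
have hb : prob_vec b.
  split=> [j|]; first by rewrite mxE divr_ge0 // addr_ge0.
  under eq_bigr do rewrite mxE; rewrite -mulr_suml big_split /= !sum1; lra.
have pr i : \sum_j p i j = (i == i0)%:R.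
  by under eq_bigr do rewrite mxE -mulnb natrM; rewrite -mulr_sumr sum1 mulr1.
have pc j : \sum_i p i j = (j == j0)%:R.
  by under eq_bigr do rewrite mxE -mulnb natrM; rewrite -mulr_suml sum1 mul1r.
have mass1 : \sum_i \sum_j p i j = 1.
  by under eq_bigr do rewrite pr; exact: sum1.
have := error_bound_constant_lower (i0 := i0) (b := b) (p := p)
  (d := Num.sqrt (1 / 2)) (h := 1 / 2) hB hb.
rewrite mass1 sqrtr_gt0 sqr_sqrtr; last by lra.
move=> /(_ _ _ _ _ _) h.
have : Num.sqrt (1 / 2) <= B * (1 / 2).
  apply: h => //.
  - by move=> i j; rewrite mxE; case: (_ && _).
  - rewrite (bigD1 j0) //= (bigD1 j1) //= !mxE !eqxx (negPf j10) eq_sym.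
    rewrite (negPf j10) /= addrA -[leLHS]addr0; apply: lerD; first by lra.
    by apply: sumr_ge0 => j _; exact: sqr_ge0.
  - apply: residual_le => [||i|j]; first by lra.
    + by rewrite /mass_res mass1 subrr normr0; lra.
    + by rewrite /row_res pr mxE eqxx subrr normr0; lra.
    + rewrite /col_res pc mxE.
      have [->|_] := eqVneq j j0.
        by rewrite eq_sym (negPf j10) /= ger0_norm; lra.
      by case: (j == j1); rewrite /= ler0_norm; lra.
move=> h2; have : Num.sqrt (1 / 2) ^+ 2 <= (B * (1 / 2)) ^+ 2 :> R.
  by rewrite ler_pXn2r ?nnegrE ?sqrtr_ge0 // (le_trans _ h2) ?sqrtr_ge0.
by rewrite sqr_sqrtr ?exprMn; lra.
Qed.

Lemma coupling_tr (m n : nat) (a : 'rV[R]_m) (b : 'rV[R]_n) p :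
  coupling a b p -> coupling b a p^T.
Proof.
move=> [p0 pr pc]; split=> [i j|i|j]; first by rewrite mxE.
- by rewrite -(pc i) /row_res; under eq_bigr do rewrite mxE.
- by rewrite -(pr j) /col_res; under eq_bigr do rewrite mxE.
Qed.

(** Exchanging the roles of [m] and [n] gives [2 <= B ^+ 2] also when [1 < m]. *)
Lemma error_bound_constant_tr (m n : nat) (B : R) :
  error_bound_constant m n B -> error_bound_constant n m B.
Proof.
move=> hB b a hb ha p p0 p1.
have mass : \sum_i \sum_j p^T i j = \sum_i \sum_j p i j.
  by rewrite exchange_big /=; do 2!apply: eq_bigr => ? _; rewrite mxE.
have -> : residual b a p = residual a b p^T.
  rewrite /residual /mass_res mass maxC [in RHS]maxC; congr (Num.max _ _).
  rewrite maxC; congr (Num.max _ _); apply: eq_bigr => k _; congr `|_|.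
    by rewrite /col_res /row_res; under [in RHS]eq_bigr do rewrite mxE.
  by rewrite /col_res /row_res; under [in RHS]eq_bigr do rewrite mxE.
have -> : dist_coupling b a p = dist_coupling a b p^T.
  congr inf; apply/seteqP; split => _ [q hq <-]; exists q^T;
    [exact: coupling_tr hq | congr Num.sqrt; rewrite exchange_big /=
    |exact: coupling_tr hq | congr Num.sqrt; rewrite exchange_big /=];
    by do 2!apply: eq_bigr => ? _; rewrite !mxE.
by apply: hB => //; [move=> i j; rewrite mxE | rewrite mass].
Qed.

(** Outside [m = n = 1], where the left-hand side is zero, [2 <= B ^+ 2] reduces the claim to an
    integer inequality. The factor [9 / 4] is the square of [3 / 2], which the balancing of two
    error terms doubles into the final 3. *)
Lemma penalty_constant_le (m n : nat) (B : R) :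
  (0 < m)%N -> (0 < n)%N -> error_bound_constant m n B ->
  (2 * (m + n) * ((1 < m) + (1 < n)))%:R <= 9 / 4 * (m * n)%:R * B ^+ 2 :> R.
Proof.
move=> m0 n0 hB.
suff [h h0] : (4 * (2 * (m + n) * ((1 < m) + (1 < n))) <= 18 * (m * n))%N /\
    (((1 < m) || (1 < n))%N -> 2 <= B ^+ 2).
  have [h1|h1] := boolP ((1 < m) || (1 < n))%N; last first.
    move: h1; rewrite negb_or => /andP[/negPf -> /negPf ->].
    by rewrite addn0 muln0 mulr_ge0 ?sqr_ge0 // mulr_ge0 //; lra.
  apply: (@le_trans _ _ (9 / 4 * (m * n)%:R * 2)); last first.
    by rewrite ler_wpM2l ?h0 // mulr_ge0 //; lra.
  by move: h; rewrite -(ler_nat R) !(natrM _ 4) (natrM _ 18); lra.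
split.
  have [m1|m1] := ltnP 1 m; have [n1|n1] := ltnP 1 n; rewrite ?muln0 //=; nia.
case/orP => h1; first exact: (error_bound_constant_sqr_ge2 n0 h1
  (error_bound_constant_tr hB)).
exact: (error_bound_constant_sqr_ge2 m0 h1 hB).
Qed.

End ErrorBoundConstant.

(** * Polynomials and their certificates *)

Section PolynomialDegree.
Context (R : realType) (N : nat).
Local Notation poly := (mpoly N R).
Local Notation size_of := (@mmeasure N R mdeg).
Local Notation homog d := (ishomog1 (R := R) d (@mdeg N)).

Lemma msizeD_leq (p q : poly) (t : nat) :
  (size_of p <= t)%N -> (size_of q <= t)%N -> (size_of (p + q) <= t)%N.
Proof.
by move=> pt qt; rewrite (leq_trans (mmeasureD_le _ _ _)) // geq_max pt.
Qed.

Lemma msizeC_leq (c : R) : (size_of (mpolyC N c) <= 1)%N.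
Proof. by rewrite mmeasureC; case: (c != 0). Qed.

Lemma msize_homog_leq (d : nat) (p : poly) :
  p \is homog d -> (size_of p <= d.+1)%N.
Proof.
move=> /dhomogP hp; rewrite mmeasureE; apply/bigmax_leqP_seq => m hm _.
by rewrite hp.
Qed.

Lemma msize_homog (d : nat) (p : poly) :
  p != 0 -> p \is homog d -> size_of p = d.+1.
Proof. by move=> p0 /dhomogP hp; rewrite -mlead_deg // hp // mlead_supp. Qed.

(** A constant cannot cancel the leading monomial, of positive degree. An exact size is needed
    because [has_deg] asks for an equality. *)
Lemma msize_homogDC (d : nat) (p : poly) (c : R) :
  p != 0 -> p \is homog d.+1 -> size_of (p + mpolyC N c) = d.+2.
Proof.
move=> p0 hp; apply/eqP; rewrite eqn_leq; apply/andP; split.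
  apply: msizeD_leq; first exact: msize_homog_leq.
  exact: leq_trans (msizeC_leq c) _.
have hl : mlead p \in msupp p by rewrite mlead_supp.
have dl : mdeg (mlead p) = d.+1 by move/dhomogP: hp; apply.
rewrite -dl msize_mdeg_lt // mcoeff_msupp mcoeffD mcoeffC.
have -> : (mlead p == mnm0) = false.
  by apply/eqP => e; move: dl; rewrite e mdeg0.
by rewrite mulr0 addr0 -mcoeff_msupp.
Qed.

Lemma homog_pvar (k : 'I_N) : pvar R k \is homog 1.
Proof. by rewrite /pvar dhomogX; apply/eqP/mdeg1. Qed.

Lemma homog_sum (I : finType) (P : pred I) (F : I -> poly) (d : nat) :
  (forall i, P i -> F i \is homog d) -> \sum_(i | P i) F i \is homog d.
Proof. by move=> h; apply: rpred_sum. Qed.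

Lemma homog_prod_pvar (I : finType) (A : {set I}) (x : I -> 'I_N) :
  \prod_(i in A) pvar R (x i) \is homog #|A|.
Proof.
rewrite cardE -big_enum /=; elim: (enum A) => [|i s IH].
  by rewrite big_nil dhomog1.
by rewrite big_cons /= -add1n dhomogM ?homog_pvar.
Qed.

Lemma pvar_neq0 (k : 'I_N) : pvar R k != 0.
Proof. by rewrite -(mmeasure_poly_eq0 (@mdeg N)) mmeasureX. Qed.

Lemma prod_pvar_neq0 (I : finType) (A : {set I}) (x : I -> 'I_N) :
  \prod_(i in A) pvar R (x i) != 0.
Proof.
by apply/prodf_neq0 => i _; exact: pvar_neq0.
Qed.

End PolynomialDegree.

(** * Certified lower bounds on the simplex *)

Section SosBound.
Context (R : realType) (N : nat).
Implicit Types (f g : mpoly N R) (T : set (mpoly N R)).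

Lemma meval_pvar (v : 'I_N -> R) k : meval v (pvar R k) = v k.
Proof. exact: mevalXU. Qed.

Lemma meval_sos_ge0 (p : mpoly N R) v : is_sos p -> 0 <= meval v p.
Proof.
move=> [s ->]; rewrite rmorph_sum sumr_ge0 // => q _.
by rewrite rmorphXn sqr_ge0.
Qed.

Lemma sos_lb_le f T (d : R) :
  (forall c, T (f - pcst N c) -> c <= d) -> (sos_lb f T <= d%:E)%E.
Proof. by move=> h; apply: ge_ereal_sup => _ [c hc <-]; rewrite lee_fin h. Qed.

Lemma sos_lb_ge f T (c : R) : T (f - pcst N c) -> (c%:E <= sos_lb f T)%E.
Proof. by move=> h; apply: ereal_sup_ubound; exists c. Qed.

Lemma simplex_preorder_ge0 (r : nat) f v :
  simplex_preorder r f -> simplex v -> 0 <= meval v f.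
Proof.
move=> [s [hs ->]] [v0 v1]; rewrite rmorph_sum sumr_ge0 // => I _.
rewrite rmorphM mulr_ge0 //; first by apply: meval_sos_ge0; case: (hs I).
rewrite rmorph_prod prodr_ge0 // => -[k|] _ /=; first by rewrite meval_pvar.
rewrite rmorphB rmorph1 subr_ge0 rmorph_sum.
by under eq_bigr do rewrite /= meval_pvar.
Qed.

Lemma simplex0 : simplex (fun _ : 'I_N => 0 : R).
Proof. by split=> //; rewrite big1. Qed.

Lemma le_simplex_min f (c : R) :
  (forall v, simplex v -> c <= meval v f) -> c <= simplex_min f.
Proof.
move=> h; apply: lb_le_inf => [|_ [v hv <-]]; last exact: h.
by exists (meval (fun=> 0) f), (fun=> 0) => //; exact: simplex0.
Qed.

Lemma simplex_max_le f (c : R) :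
  (forall v, simplex v -> meval v f <= c) -> simplex_max f <= c.
Proof.
move=> h; apply: ge_sup => [|_ [v hv <-]]; last exact: h.
by exists (meval (fun=> 0) f), (fun=> 0) => //; exact: simplex0.
Qed.

Lemma sos_lb_le_simplex_min (r : nat) f :
  (sos_lb f (simplex_preorder r) <= (simplex_min f)%:E)%E.
Proof.
apply: sos_lb_le => c hc; apply: le_simplex_min => v hv.
by have := simplex_preorder_ge0 hc hv; rewrite rmorphB /= mevalC subr_ge0.
Qed.

(* Tested on the square of a variable, whose range on the simplex is [0, 1]. *)
Lemma simplex_constant_ge0 (C : R) :
  (0 < N)%N -> simplex_constant N 2 C -> 0 <= C.
Proof.
move=> N0 hC; move: (Ordinal N0) => k; pose f := pvar R k ^+ 2.
have fE v : meval v f = v k ^+ 2 by rewrite rmorphXn /= meval_pvar.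
have deg_f : has_deg 2 f.
  apply: msize_homog; first by rewrite expf_neq0 ?pvar_neq0.
  by have := dhomogMn 2 (homog_pvar R k); rewrite mul1n.
have v01 v : simplex v -> 0 <= v k <= 1.
  move=> [v0 v1]; rewrite v0 (le_trans _ v1) // (bigD1 k) //= lerDl.
  by apply: sumr_ge0.
have f01 v : simplex v -> 0 <= meval v f <= 1.
  by move=> /v01 /andP[v0 v1]; rewrite fE sqr_ge0 expr_le1.
have e1 : simplex (fun l : 'I_N => (l == k)%:R : R).
  split=> [l|]; first by case: (_ == _).
  by rewrite (bigD1 k) //= eqxx big1 ?addr0 // => l /negPf ->.
have min0 : simplex_min f <= 0.
  apply: ge_inf; first by exists 0 => _ [v /f01 /andP[? _] <-].
  by exists (fun=> 0); [exact: simplex0 | rewrite fE expr0n].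
have max1 : 1 <= simplex_max f.
  apply: ub_le_sup; first by exists 1 => _ [v /f01 /andP[_ ?] <-].
  by eexists; [exact: e1 | rewrite fE /= eqxx expr1n].
(* At the smallest admissible level the gap is nonnegative by soundness, while the range of [f] has
   length at least 1; this forces the sign of [C]. *)
have := hC f deg_f (2 * N * 2)%N (leqnn _).
have := sos_lb_le_simplex_min (2 * N * 2) f; rewrite -sube_ge0 ?orbT //.
move=> h1 h2; have := le_trans h1 h2; rewrite lee_fin.
rewrite pmulr_lge0; last by lra.
by rewrite pmulr_lge0 // invr_gt0 exprn_gt0 // ltr0n !muln_gt0 N0.
Qed.

End SosBound.

(** * The truncated ideal of the marginal constraints *)

Section MarginalIdeal.
Context (R : realType) (m n : nat) (a : 'rV[R]_m) (b : 'rV[R]_n).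
Local Notation poly := (mpoly (m * n) R).
Local Notation size_of := (@mmeasure (m * n) R mdeg).
Local Notation homog d := (ishomog1 (R := R) d (@mdeg (m * n))).
Local Notation var := (@pi_var R m n).
Local Notation cst := (@pcst R (m * n)).

Definition row_gen (i : 'I_m) : poly := cst (a 0 i) - \sum_j var i j.
Definition col_gen (j : 'I_n) : poly := cst (b 0 j) - \sum_i var i j.

(** [t] bounds [1 + deg] of the multipliers: they are constants for [t = 1], and [t = 2 * r] is the
    bound imposed in [coupling_preorder]. *)
Definition marginal_ideal (t : nat) (p : poly) : Prop :=
  exists (lam : 'I_m -> poly) (theta : 'I_n -> poly),
    [/\ forall i, (size_of (lam i) <= t)%N,
        forall j, (size_of (theta j) <= t)%N &
        p = \sum_i lam i * row_gen i + \sum_j theta j * col_gen j].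

Lemma marginal_ideal0 t : marginal_ideal t 0.
Proof.
exists (fun=> 0), (fun=> 0); split=> [i|j|]; rewrite ?mmeasure0 //.
by rewrite !big1 ?addr0 // => *; rewrite mul0r.
Qed.

Lemma marginal_idealD t p q :
  marginal_ideal t p -> marginal_ideal t q -> marginal_ideal t (p + q).
Proof.
move=> [l1 [t1 [hl1 ht1 ->]]] [l2 [t2 [hl2 ht2 ->]]].
exists (fun i => l1 i + l2 i), (fun j => t1 j + t2 j).
split=> [i|j|]; rewrite ?msizeD_leq //.
rewrite addrACA -!big_split /=.
by congr (_ + _); apply: eq_bigr => *; rewrite mulrDl.
Qed.

Lemma marginal_ideal_sum t (I : finType) (P : pred I) (F : I -> poly) :
  (forall i, P i -> marginal_ideal t (F i)) ->
  marginal_ideal t (\sum_(i | P i) F i).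
Proof.
move=> h; apply: (big_ind (marginal_ideal t)) => //.
  exact: marginal_ideal0.
exact: marginal_idealD.
Qed.

(** Multipliers of size at most 1 are constants, so their products with [A] are no larger than
    [A]. *)
Lemma marginal_idealM t A p :
  marginal_ideal 1 p -> (size_of A <= t)%N -> marginal_ideal t (A * p).
Proof.
move=> [l [u [hl hu ->]]] hA; exists (fun i => A * l i), (fun j => A * u j).
have hc (q : poly) : (size_of q <= 1)%N -> (size_of (A * q) <= t)%N.
  move=> /msize1_polyC ->; rewrite mulrC mul_mpolyC.
  exact: leq_trans (mmeasureZ_le _ _ _) hA.
split=> [i|j|]; rewrite ?hc // mulrDr !mulr_sumr.
by congr (_ + _); apply: eq_bigr => *; rewrite mulrA.
Qed.

Lemma marginal_idealS t u p :
  (t <= u)%N -> marginal_ideal t p -> marginal_ideal u p.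
Proof.
move=> tu [l [th [hl ht ->]]]; exists l, th.
by split=> // k; apply: leq_trans tu.
Qed.

Lemma sum_deltaM (I : finType) (i : I) (F : I -> poly) :
  \sum_k (k == i)%:R * F k = F i.
Proof.
rewrite (bigD1 i) //= eqxx mul1r big1 ?addr0 // => k /negPf ->.
by rewrite mul0r.
Qed.

Lemma msize_bool (c : bool) : (size_of c%:R <= 1)%N.
Proof. by case: c; rewrite ?mmeasure1 ?mmeasure0. Qed.

Lemma marginal_ideal_row i : marginal_ideal 1 (row_gen i).
Proof.
exists (fun k => (k == i)%:R), (fun=> 0); split=> [k|j|].
- exact: msize_bool.
- by rewrite mmeasure0.
by rewrite sum_deltaM big1 ?addr0 // => *; rewrite mul0r.
Qed.

Lemma marginal_ideal_col j : marginal_ideal 1 (col_gen j).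
Proof.
exists (fun=> 0), (fun k => (k == j)%:R); split=> [k|k|].
- by rewrite mmeasure0.
- exact: msize_bool.
by rewrite sum_deltaM big1 ?add0r // => *; rewrite mul0r.
Qed.

Lemma marginal_idealZ (c : R) p :
  marginal_ideal 1 p -> marginal_ideal 1 (c *: p).
Proof.
by move=> h; rewrite -mul_mpolyC; apply: marginal_idealM (msizeC_leq _ c).
Qed.

Definition mass_poly : poly := \sum_i \sum_j var i j.
(** The marginal constraints made homogeneous by multiplying their constants by the mass; up to
    sign, nothing changes modulo [1 - mass_poly]. *)
Definition row_hom (i : 'I_m) : poly := \sum_j var i j - a 0 i *: mass_poly.
Definition col_hom (j : 'I_n) : poly := \sum_i var i j - b 0 j *: mass_poly.
Definition penalty_poly : poly := (m + n)%:R *: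
  (\sum_i row_hom i ^+ 2 + \sum_j col_hom j ^+ 2).

Lemma homog_mass : mass_poly \is homog 1.
Proof. by do 2!apply: homog_sum => ? _; exact: homog_pvar. Qed.

Lemma homog_row i : row_hom i \is homog 1.
Proof.
rewrite rpredB ?dhomogZ ?homog_mass //.
by apply: homog_sum => ? _; exact: homog_pvar.
Qed.

Lemma homog_col j : col_hom j \is homog 1.
Proof.
rewrite rpredB ?dhomogZ ?homog_mass //.
by apply: homog_sum => ? _; exact: homog_pvar.
Qed.

Context (a1 : \sum_i a 0 i = 1).

Lemma marginal_ideal_mass : marginal_ideal 1 (1 - mass_poly).
Proof.
have -> : 1 - mass_poly = \sum_i row_gen i.
  rewrite sumrB -/mass_poly; congr (_ - _).
  by rewrite -[LHS](mpolyC1 (m * n) R) -a1 rmorph_sum.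
by apply: marginal_ideal_sum => i _; exact: marginal_ideal_row.
Qed.

Lemma marginal_ideal_row_hom i : marginal_ideal 1 (row_hom i).
Proof.
have -> : row_hom i = a 0 i *: (1 - mass_poly) + (-1) *: row_gen i.
  by rewrite /row_gen /pcst -alg_mpolyC scalerBr scaleN1r opprB /row_hom; ring.
apply: marginal_idealD; first exact/marginal_idealZ/marginal_ideal_mass.
exact/marginal_idealZ/marginal_ideal_row.
Qed.

Lemma marginal_ideal_col_hom j : marginal_ideal 1 (col_hom j).
Proof.
have -> : col_hom j = b 0 j *: (1 - mass_poly) + (-1) *: col_gen j.
  by rewrite /col_gen /pcst -alg_mpolyC scalerBr scaleN1r opprB /col_hom; ring.
apply: marginal_idealD; first exact/marginal_idealZ/marginal_ideal_mass.
exact/marginal_idealZ/marginal_ideal_col.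
Qed.

(* Homogenizing with the mass keeps the maximum over the simplex at [K], so
   that the deficit of mass costs nothing in the error bound. *)
Definition penalized (L : 'I_m -> 'I_n -> 'I_m -> 'I_n -> R) (P K : R) : poly :=
  GW_poly L + P *: penalty_poly - K *: mass_poly ^+ 2 + cst K.

(** Every term of the difference is a linear element of the ideal times a factor of degree at most
    1: squares split as [h * h], and [1 - mass ^ 2] as [(1 + mass) (1 - mass)]. *)
Lemma marginal_ideal_penalized L P K :
  marginal_ideal 2 (GW_poly L - penalized L P K).
Proof.
have -> : GW_poly L - penalized L P K =
    (cst (- P * (m + n)%:R) * (\sum_i row_hom i ^+ 2)) +
    (cst (- P * (m + n)%:R) * (\sum_j col_hom j ^+ 2)) +
    (cst (- K) * (1 + mass_poly)) * (1 - mass_poly).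
  rewrite /penalized /pcst /penalty_poly -!mul_mpolyC !rmorphM !rmorphN /=.
  by ring.
rewrite !mulr_sumr; apply: marginal_idealD; first apply: marginal_idealD.
- apply: marginal_ideal_sum => i _; rewrite expr2 mulrA; apply: marginal_idealM.
    exact: marginal_ideal_row_hom.
  rewrite mul_mpolyC (leq_trans (mmeasureZ_le _ _ _)) //.
  exact/msize_homog_leq/homog_row.
- apply: marginal_ideal_sum => j _; rewrite expr2 mulrA; apply: marginal_idealM.
    exact: marginal_ideal_col_hom.
  rewrite mul_mpolyC (leq_trans (mmeasureZ_le _ _ _)) //.
  exact/msize_homog_leq/homog_col.
apply: marginal_idealM; first exact: marginal_ideal_mass.
rewrite mul_mpolyC (leq_trans (mmeasureZ_le _ _ _)) // msizeD_leq //.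
  by rewrite mmeasure1.
exact/msize_homog_leq/homog_mass.
Qed.

Lemma homog_penalized L P K :
  GW_poly L + P *: penalty_poly - K *: mass_poly ^+ 2 \is homog 2.
Proof.
have hX (p : poly) : p \is homog 1 -> p ^+ 2 \is homog 2.
  by move=> hp; exact: (dhomogM hp hp).
rewrite rpredB ?rpredD ?dhomogZ ?hX ?homog_mass ?rpredD //.
- do 4!apply: homog_sum => ? _.
  by apply/dhomogZ/(dhomogM (homog_pvar R _) (homog_pvar R _)).
- by apply: homog_sum => i _; rewrite hX ?homog_row.
- by apply: homog_sum => j _; rewrite hX ?homog_col.
Qed.

(** * Evaluation at matrices and soundness *)

Definition point_mx (v : 'I_(m * n) -> R) : 'M[R]_(m, n) :=
  \matrix_(i, j) v (mxvec_index i j).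

Lemma meval_sum_pvar (I : finType) (v : 'I_(m * n) -> R) (P : pred I)
    (x : I -> 'I_(m * n)) :
  meval v (\sum_(i | P i) pvar R (x i)) = \sum_(i | P i) v (x i).
Proof. by rewrite rmorph_sum; apply: eq_bigr => i _; rewrite /= meval_pvar. Qed.

Lemma meval_mass v : meval v mass_poly = \sum_i \sum_j point_mx v i j.
Proof.
rewrite rmorph_sum; apply: eq_bigr => i _ /=; rewrite meval_sum_pvar.
by apply: eq_bigr => j _; rewrite mxE.
Qed.

Lemma meval_GW_poly L v : meval v (GW_poly L) = GW_obj L (point_mx v).
Proof.
do 4![rewrite rmorph_sum /=; apply: eq_bigr => ? _].
by rewrite mevalZ rmorphM /= !meval_pvar !mxE mulrA.
Qed.

Lemma meval_row_hom v i : meval v (row_hom i) = \sum_j point_mx v i j -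
  a 0 i * \sum_i \sum_j point_mx v i j.
Proof.
rewrite rmorphB /= mevalZ meval_mass meval_sum_pvar; congr (_ - _).
by apply: eq_bigr => j _; rewrite mxE.
Qed.

Lemma meval_col_hom v j : meval v (col_hom j) = \sum_i point_mx v i j -
  b 0 j * \sum_i \sum_j point_mx v i j.
Proof.
rewrite rmorphB /= mevalZ meval_mass meval_sum_pvar; congr (_ - _).
by apply: eq_bigr => i _; rewrite mxE.
Qed.

Lemma meval_penalized L P K v : meval v (penalized L P K) =
  GW_obj L (point_mx v) + P * penalty a b (point_mx v)
  - K * (\sum_i \sum_j point_mx v i j) ^+ 2 + K.
Proof.
rewrite /penalized /penalty_poly rmorphD rmorphB rmorphD /= mevalC !mevalZ.
rewrite rmorphXn /= meval_mass meval_GW_poly mevalD !rmorph_sum /=.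
congr (_ + _ * (_ * (_ + _)) - _ + _); apply: eq_bigr => k _.
  by rewrite rmorphXn /= meval_row_hom.
by rewrite rmorphXn /= meval_col_hom.
Qed.

Lemma sum_mxvec_index (V : nmodType) (v : 'I_(m * n) -> V) :
  \sum_k v k = \sum_i \sum_j v (mxvec_index i j).
Proof.
rewrite pair_big (reindex _ (curry_mxvec_bij m n)) /=.
by apply: eq_bigr => -[i j].
Qed.

Lemma simplex_point_mx v : simplex v ->
  (forall i j, 0 <= point_mx v i j) /\ \sum_i \sum_j point_mx v i j <= 1.
Proof.
move=> [v0 v1]; split=> [i j|]; first by rewrite mxE.
apply: le_trans v1; rewrite sum_mxvec_index le_eqVlt; apply/orP; left.
by apply/eqP; do 2!apply: eq_bigr => ? _; rewrite mxE.
Qed.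

(** At a coupling the marginal terms of the certificate vanish whatever their multipliers, and the
    others are nonnegative. *)
Lemma GW_lb_sound L r p (c : R) : coupling a b p ->
  coupling_preorder a b r (GW_poly L - pcst _ c) -> c <= GW_obj L p.
Proof.
move=> hp; pose v k := mxvec p 0 k.
have vp : point_mx v = p by apply/matrixP => i j; rewrite mxE /v mxvecE.
have mv i j : meval v (var i j) = p i j by rewrite -[p in RHS]vp mxE meval_pvar.
move=> [s0 [s [lam [theta [[sos0 _] hs _ _]]]]] /(congr1 (meval v)).
rewrite rmorphB /= mevalC meval_GW_poly vp => e; rewrite -subr_ge0 e.
rewrite !rmorphD !rmorph_sum /= [X in _ + X]big1 => [|j _]; last first.
  rewrite rmorphM rmorphB /= mevalC rmorph_sum /=.
  under eq_bigr do rewrite mv.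
  by rewrite (coupling_colE j hp) subrr mulr0.
rewrite [X in _ + X + _]big1 => [|i _]; last first.
  rewrite rmorphM rmorphB /= mevalC rmorph_sum /=.
  under eq_bigr do rewrite mv.
  by rewrite (coupling_rowE i hp) subrr mulr0.
rewrite !addr0 addr_ge0 ?meval_sos_ge0 ?sumr_ge0 // => I hI.
rewrite rmorphM mulr_ge0 //; last by apply: meval_sos_ge0; case: (hs I hI).
rewrite rmorph_prod prodr_ge0 // => -[i j] _ /=.
by rewrite mv (coupling_ge0 i j hp).
Qed.

(** * From simplex certificates to coupling certificates *)

Definition lift_pairs (I : {set 'I_m * 'I_n}) : {set option 'I_(m * n)} :=
  [set Some (mxvec_index ij.1 ij.2) | ij in I].

Lemma mxvec_pair_inj :
  injective (fun ij : 'I_m * 'I_n => Some (mxvec_index ij.1 ij.2)).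
Proof.
by move=> [i j] [k l] /Some_inj /cast_ord_inj /enum_rank_inj.
Qed.

Lemma monom_lift I : monom R I = \prod_(k in lift_pairs I) simplex_gen R k.
Proof. by rewrite big_imset //= => x y _ _; exact: mxvec_pair_inj. Qed.

Lemma homog_monom (I : {set 'I_m * 'I_n}) : monom R I \is homog #|I|.
Proof. exact: homog_prod_pvar. Qed.

Lemma monom_neq0 (I : {set 'I_m * 'I_n}) : monom R I != 0.
Proof. exact: prod_pvar_neq0. Qed.

(** Degrees add in a domain. The second conclusion covers [t < d], where the truncated [t - d] would
    say too little. *)
Lemma msizeM_homog (A B : poly) (d t : nat) : B != 0 -> B \is homog d ->
  (size_of (A * B) <= t.+1)%N -> (size_of A <= (t - d).+1)%N /\
   ((t < d)%N -> A = 0).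
Proof.
move=> B0 hB; have [-> _|A0] := eqVneq A 0; first by rewrite mmeasure0.
rewrite msizeM // (msize_homog B0 hB) addnS /= => h.
move: A0; rewrite -(mmeasure_poly_eq0 (@mdeg (m * n))) .
move: h; move: (mmeasure _ A) => k h k0.
by split; [lia | move=> td; exfalso; lia].
Qed.

Lemma mass_poly_neq0 : (0 < m)%N -> (0 < n)%N -> mass_poly != 0.
Proof.
move=> m0 n0; apply/eqP => /(congr1 (meval (fun=> 1))) /eqP.
rewrite meval_mass meval0; under eq_bigr do under eq_bigr do rewrite mxE.
under eq_bigr do rewrite sumr_const card_ord.
by rewrite sumr_const card_ord -mulrnA pnatr_eq0 muln_eq0 !eqn0Ngt m0 n0.
Qed.

Lemma msize_mass_residue :
  (0 < m)%N -> (0 < n)%N -> size_of (1 - mass_poly) = 2%N.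
Proof.
move=> m0 n0; rewrite addrC -(mpolyC1 (m * n) R).
apply: msize_homogDC; first by rewrite oppr_eq0 mass_poly_neq0.
by rewrite rpredN homog_mass.
Qed.

Lemma simplex_gen_None : simplex_gen R None = 1 - mass_poly :> poly.
Proof. by rewrite /= sum_mxvec_index. Qed.

Lemma sum_lift (F : {set option 'I_(m * n)} -> poly) :
  \sum_(U : {set option 'I_(m * n)} | None \notin U) F U =
    \sum_I F (lift_pairs I).
Proof.
pose unlift (U : {set option 'I_(m * n)}) : {set 'I_m * 'I_n} :=
  finset (fun ij => Some (mxvec_index ij.1 ij.2) \in U).
have liftK : cancel lift_pairs unlift.
  move=> I; apply/setP => ij; rewrite inE mem_imset //.
  exact: mxvec_pair_inj.
rewrite (reindex_onto lift_pairs unlift) /= => [|U NU].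
  apply: eq_bigl => I; rewrite liftK eqxx andbT.
  by apply/negP => /imsetP[].
apply/setP => -[k|]; last by rewrite (negPf NU); apply/negP => /imsetP[].
case: (mxvec_indexP k) => i j.
by rewrite (mem_imset _ (i, j)) ?inE //; exact: mxvec_pair_inj.
Qed.

(* A product containing the generator [1 - \sum pi] of the simplex lies in the
   ideal of the marginal constraints. *)
Lemma coupling_preorder_simplex r (f g : poly) : (0 < m)%N -> (0 < n)%N ->
  simplex_preorder r f -> marginal_ideal (2 * r) (g - f) ->
  coupling_preorder a b r g.
Proof.
move=> m0 n0 [s [hs ef]] hgf.
have hI (I : {set 'I_m * 'I_n}) :
    (size_of (s (lift_pairs I)) <= (2 * r - #|I|).+1)%N /\
    ((2 * r < #|I|)%N -> s (lift_pairs I) = 0).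
  apply: (msizeM_homog (monom_neq0 I) (homog_monom I)).
  by rewrite monom_lift; case: (hs (lift_pairs I)).
have hN : marginal_ideal (2 * r)
    (\sum_(U : {set option 'I_(m * n)} | None \in U)
       s U * \prod_(k in U) simplex_gen R k).
  apply: marginal_ideal_sum => U NU; rewrite (big_setD1 None) //=.
  rewrite -/(simplex_gen R None) simplex_gen_None mulrCA mulrC.
  apply: marginal_idealM; first exact: marginal_ideal_mass.
  (* [1 - mass_poly] has size exactly 2, so taking it out lowers the degree from at most [2 * r] to
     at most [2 * r - 1], which is size [2 * r]. *)
  case: (hs U) => _; rewrite /deg_le /Defs.msize (big_setD1 None) //=.
  rewrite -/(simplex_gen R None) simplex_gen_None mulrCA mulrC.
  set A := s U * _; have [->|A0] := eqVneq A 0; first by rewrite mmeasure0.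
  have e2 := msize_mass_residue m0 n0.
  rewrite msizeM ?e2 // -?(mmeasure_poly_eq0 (@mdeg (m * n))) ?e2 //.
  by rewrite addn2.
have [lam [theta [hl ht e]]] := marginal_idealD hgf hN.
(* The free term [s0] can be 0: the empty set of pairs already carries a sum of squares. *)
exists 0, (s \o lift_pairs), lam, theta; split=> //.
- split; first by exists [::]; rewrite big_nil.
  by rewrite /deg_le /Defs.msize mmeasure0.
- move=> I _; split; first by case: (hs (lift_pairs I)).
  by case: (hI I).
rewrite add0r -addrA -e -[LHS](subrK f); move: (g - f) => h.
rewrite ef (bigID (fun U : {set _} => None \in U)) /= sum_lift.
rewrite addrA [RHS]addrC; congr (_ + _).
(* Sets of more than [2 * r] pairs have a zero multiplier, by [hI]. *)
rewrite [LHS](bigID (fun I : {set _} => #|I| <= 2 * r)%N) /= addrC big1 ?add0r.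
  by apply: eq_bigr => I _; rewrite -monom_lift mulrC.
by move=> I; rewrite -ltnNge => /(hI I).2 ->; rewrite mul0r.
Qed.

End MarginalIdeal.

(** * The penalized polynomial *)

Section PenaltyBound.
Context (R : realType) (m n : nat) (a : 'rV[R]_m) (b : 'rV[R]_n).
Context (ha : prob_vec a) (hb : prob_vec b).
Context (L : 'I_m -> 'I_n -> 'I_m -> 'I_n -> R).
Local Notation D := (DGW L a b).
Local Notation K := (max_coeff L).

Lemma prob_vec_gt0 (k : nat) (u : 'rV[R]_k) : prob_vec u -> (0 < k)%N.
Proof.
case: k u => // u [_ /eqP]; rewrite big_ord0 eq_sym.
by rewrite oner_eq0.
Qed.

(** With [s] the mass and [K' = K + P Q], the part [L + P q] is at least [(D - e) s ^ 2], and
    [K' (1 - s ^ 2)] is at least [(D - e) (1 - s ^ 2)] because [D - e <= K']. *)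
Lemma penalized_ge (P e Q : R) v :
  0 <= P -> 0 <= e -> 0 <= Q -> K ^+ 2 <= P * e -> simplex v ->
  D - e <= meval v (penalized a b L P (K + P * Q)).
Proof.
move=> P0 e0 Q0 KPe /simplex_point_mx[p0 s1]; rewrite meval_penalized.
have := GW_obj_penalty_ge ha hb P0 e0 KPe p0.
have s0 : 0 <= \sum_i \sum_j point_mx v i j.
  by do 2!apply: sumr_ge0 => ? _; exact: p0.
move: s0 s1; set s := \sum_i _ => s0 s1 h.
have : (D - e) * (1 - s ^+ 2) <= (K + P * Q) * (1 - s ^+ 2).
  rewrite ler_wpM2r ?subr_ge0 ?expr_le1 //.
  have := DGW_le_max ha hb L; have : 0 <= P * Q by rewrite mulr_ge0.
  lra.
lra.
Qed.

(** [L <= K s ^ 2] and [q <= Q s ^ 2], so the term [- K' s ^ 2] absorbs both. *)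
Lemma penalized_le (P Q : R) v : 0 <= P ->
  (2 * (m + n) * ((1 < m) + (1 < n)))%:R <= Q ->
  simplex v -> meval v (penalized a b L P (K + P * Q)) <= K + P * Q.
Proof.
move=> P0 hQ /simplex_point_mx[p0 _]; rewrite meval_penalized.
have := norm_GW_obj_le L p0; have := penalty_le ha hb p0.
set s := \sum_i _ => h1 /(le_trans (ler_norm _)) h2.
have : P * penalty a b (point_mx v) <= P * (Q * s ^+ 2).
  by rewrite ler_wpM2l // (le_trans h1) // ler_wpM2r ?sqr_ge0.
lra.
Qed.

Lemma sos_lb_penalized_le (P Q : R) (r : nat) : (0 < r)%N ->
  (sos_lb (penalized a b L P Q) (simplex_preorder r) <= GW_lb L a b r)%E.
Proof.
move=> r0; apply: ge_ereal_sup => _ [c hc <-]; apply: sos_lb_ge.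
apply: (coupling_preorder_simplex ha.2 (prob_vec_gt0 ha) (prob_vec_gt0 hb) hc).
rewrite opprB addrA subrK.
apply: marginal_idealS (marginal_ideal_penalized _ ha.2 _ _ _).
by rewrite leq_pmulr.
Qed.

(** The simplex rate is applied to the penalized polynomial, whose values on the simplex lie between
    [D - e] and [K + P Q]. *)
Lemma GW_lb_penalty_ge (C P e Q : R) (r : nat) :
  simplex_constant (m * n) 2 C -> (4 * (m * n) <= r)%N ->
  0 <= P -> 0 <= e -> K ^+ 2 <= P * e ->
  (2 * (m + n) * ((1 < m) + (1 < n)))%:R <= Q ->
  ((D - e - C / r%:R ^+ 2 * (K + P * Q - D + e))%:E <= GW_lb L a b r)%E.
Proof.
move=> hC hr P0 e0 KPe hQ; have [m0 n0] := (prob_vec_gt0 ha, prob_vec_gt0 hb).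
have mn0 : (0 < m * n)%N by rewrite muln_gt0 m0.
have r0 : (0 < r)%N by apply: leq_trans hr; rewrite muln_gt0.
have Q0 : 0 <= Q by apply: le_trans hQ.
have tau0 : 0 <= C / r%:R ^+ 2.
  by rewrite divr_ge0 ?(simplex_constant_ge0 mn0 hC) // exprn_ge0.
have PQ0 : 0 <= P * Q by rewrite mulr_ge0.
have DK := DGW_le_max ha hb L.
apply: le_trans (sos_lb_penalized_le P (K + P * Q) r0).
set F := penalized _ _ _ _ _; set tau := C / _.
(* If the quadratic part vanishes, [F] does not have degree 2 and the rate does not apply; but [F]
   is then the constant [K + P Q], certified by zero multipliers. *)
have [F0|F0] := eqVneq (GW_poly L + P *: penalty_poly a b
    - (K + P * Q) *: mass_poly R m n ^+ 2) 0.
  apply: (@le_trans _ _ (K + P * Q)%:E).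
    rewrite lee_fin; have : 0 <= tau * (K + P * Q - D + e).
      by rewrite mulr_ge0 //; lra.
    by lra.
  apply: sos_lb_ge; rewrite /F /penalized F0 add0r subrr.
  exists (fun=> 0); split=> [I|]; last by rewrite big1 // => ? _; rewrite mul0r.
  split; first by exists [::]; rewrite big_nil.
  by rewrite mul0r /deg_le /Defs.msize mmeasure0.
have dF : has_deg 2 F by apply: msize_homogDC => //; exact: homog_penalized.
have hr' : (2 * (m * n) * 2 <= r)%N by apply: leq_trans hr; lia.
have hmin : D - e <= simplex_min F.
  by apply: le_simplex_min => v; exact: penalized_ge.
have hmax : simplex_max F <= K + P * Q.
  by apply: simplex_max_le => v; exact: penalized_le.
have := hC F dF r hr'; rewrite -/tau.
case: (sos_lb F _) => [x| |]; rewrite ?leey // -?EFinB ?lee_fin // => h.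
have : tau * (simplex_max F - simplex_min F) <= tau * (K + P * Q - (D - e)).
  by rewrite ler_wpM2l //; lra.
lra.
Qed.

(* The penalty [P] balances the two error terms [e = K ^+ 2 / P] and
   [tau * P * Q], with [Q = 9 / 4 * S ^+ 2 * B ^+ 2] and [tau = t ^+ 2]. *)
Lemma GW_lb_ge (B C : R) (r : nat) (S := Num.sqrt (m * n)%:R) :
  error_bound_constant m n B -> simplex_constant (m * n) 2 C ->
  (4 * (m * n) <= r)%N ->
  ((D - (C / r%:R ^+ 2 * (K - D + 3 * S * K * B)
         + Num.sqrt C / r%:R * (3 * S * K * B)))%:E <= GW_lb L a b r)%E.
Proof.
move=> hB hC hr; have [m0 n0] := (prob_vec_gt0 ha, prob_vec_gt0 hb).
have mn0 : (0 < m * n)%N by rewrite muln_gt0 m0.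
have r0 : (0 < r)%N by apply: leq_trans hr; rewrite muln_gt0.
have C0 := simplex_constant_ge0 mn0 hC.
have K0 : 0 <= K := max_coeff_ge0 L.
have B1 := error_bound_constant_ge1 m0 n0 hB.
have S0 : 0 < S by rewrite sqrtr_gt0 ltr0n.
have hQ := penalty_constant_le m0 n0 hB.
have SS : S ^+ 2 = (m * n)%:R by rewrite sqr_sqrtr.
rewrite -SS in hQ.
have := GW_lb_penalty_ge hC hr _ _ _ hQ.
set t := Num.sqrt C / r%:R; have -> : C / r%:R ^+ 2 = t ^+ 2.
  by rewrite /t exprMn sqr_sqrtr // exprVn.
have t0 : 0 <= t by rewrite divr_ge0 ?sqrtr_ge0.
(* [t = 0] means [C = 0]: a large penalty is then free, and [P = K ^ 2 / e] with [e] arbitrarily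
   small concludes. *)
have [t00|tn0] := eqVneq t 0.
  rewrite t00 expr0n /= => h; rewrite !mul0r addr0 subr0.
  apply/lee_addgt0Pr => e e0; rewrite -leeBlDr // -EFinB.
  have := h (K ^+ 2 / e) e; rewrite mul0r subr0; apply.
  - by rewrite divr_ge0 ?sqr_ge0 ?ltW.
  - exact: ltW.
  - by rewrite divfK ?gt_eqF.
have tgt0 : 0 < t by rewrite lt_def tn0.
have B0 : 0 < B by lra.
have t1 : 0 < 1 + t by lra.
(* Exact balancing would involve the root of [1 + t ^ 2]. With [1 + t] instead, still [P e = K ^ 2],
   and [e (1 + t ^ 2)] and [t ^ 2 P Q] are each at most [3 / 2 S K B (t + t ^ 2)]. *)
pose P := 2 * K * (1 + t) / (3 * S * B * t).
pose e := 3 / 2 * S * K * B * t / (1 + t).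
have den0 : 0 < 3 * S * B * t.
  by apply: mulr_gt0 tgt0; apply: mulr_gt0 B0; apply: mulr_gt0 S0.
have P0 : 0 <= P.
  by apply: divr_ge0 (ltW den0); apply: mulr_ge0 (ltW t1); apply: mulr_ge0.
have SKB0 : 0 <= 3 / 2 * S * K * B.
  apply: mulr_ge0 (ltW B0); apply: mulr_ge0 K0.
  by apply: mulr_ge0 (ltW S0); lra.
have e0 : 0 <= e by apply: divr_ge0 (ltW t1); apply: mulr_ge0.
have KPe : K ^+ 2 = P * e.
  rewrite /P /e; field.
  by rewrite !gt_eqF.
move=> /(_ P e P0 e0); rewrite {1}KPe lexx => /(_ isT) h.
apply: le_trans h; rewrite lee_fin.
have -> : P * (9 / 4 * S ^+ 2 * B ^+ 2) = 3 / 2 * S * K * B * (1 + t) / t.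
  by rewrite /P; field; rewrite !gt_eqF.
have e1 : e * (1 + t ^+ 2) <= 3 / 2 * S * K * B * t * (1 + t).
  rewrite /e mulrAC ler_pdivrMr // -[leRHS]mulrA ler_wpM2l //.
    by rewrite !mulr_ge0 //; lra.
  by have := sqr_ge0 t; lra.
have e2 : t ^+ 2 * (3 / 2 * S * K * B * (1 + t) / t) =
    3 / 2 * S * K * B * t * (1 + t) by field.
set X := _ * (1 + t) / t in e2 *.
have -> : t ^+ 2 * (K + X - D + e) = t ^+ 2 * (K - D) + t ^+ 2 * X + e * t ^+ 2.
  by ring.
by rewrite e2; lra.
Qed.

Lemma GW_lb_le (r : nat) : (GW_lb L a b r <= D%:E)%E.
Proof.
apply: sos_lb_le => c hc; apply: (le_DGW ha hb) => p hp; exact: GW_lb_sound hc.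
Qed.

End PenaltyBound.

(** * Weights and convergence *)

Lemma borel_measurable_set1 (R : realType) (T : pmetricType R) (t : T) :
  measurable ([set t] : set (borelType T)).
Proof.
rewrite -[X in measurable X]setCK; apply: measurableC; apply: sub_sigma_algebra.
apply: closed_openC; apply: accessible_closed_set1.
exact/hausdorff_accessible/metric_hausdorff.
Qed.

(** The points being distinct, additivity turns the full measure of their range into the sum of the
    atoms. *)
Lemma prob_vec_weights (R : realType) (X : mmSpace R) (m : nat)
    (x : 'I_m -> mm_space X) : supported_on x -> prob_vec (weights x).
Proof.
move=> [xinj xsupp]; split=> [i|]; first by rewrite mxE fine_ge0.
under eq_bigr do rewrite mxE.
have mx (i : 'I_m) : measurable ([set x i] : set (borelType (mm_space X))).
  exact: borel_measurable_set1.
rewrite sum_fine; last by move=> i _; rewrite fin_num_measure.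
have rangeE : range x = \big[setU/set0]_(i < m) [set x i].
  rewrite -bigcup_seq; apply/seteqP.
  by split=> [_ [i _ <-]|_ [i _ ->]]; exists i => //=; rewrite mem_index_enum.
have mrange : measurable (range x : set (borelType (mm_space X))).
  by rewrite rangeE; apply: bigsetU_measurable.
have : mm_measure X (range x) = (\sum_i mm_measure X [set x i])%E.
  rewrite [in LHS]rangeE; apply: measure_semi_additive_ord => //.
    by move=> i j _ _ [z [/= -> /xinj]].
  by rewrite -rangeE.
move=> <-; rewrite -[range x]setCK probability_setC; last exact: measurableC.
by rewrite xsupp sube0.
Qed.

Lemma cvgr_inv_natr (R : realType) : (n%:R^-1 : R) @[n --> \oo] --> (0 : R).
Proof.
apply/gtr0_cvgV0; last exact: cvgr_idn.
by near=> n; rewrite ltr0n; near: n; exact: nbhs_infty_gt.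
Unshelve. all: by end_near. Qed.

(** From [N] on the bounds make [u] finite and squeeze it; earlier values, possibly infinite, affect
    neither the limit nor the big O. *)
Lemma rate_implies_cvg (R : realType) (D A : R) (u : nat -> \bar R) (N : nat) :
  (forall r, (N <= r)%N -> ((D - A / r%:R)%:E <= u r <= D%:E)%E) ->
  (u r @[r --> \oo] --> D%:E) /\
  ((fun r : nat => D - fine (u r) : R^o) =O_\oo (fun r : nat => r%:R^-1 : R^o)).
Proof.
move=> hu.
have ufin r : (N <= r)%N -> u r \is a fin_num.
  move=> /hu /andP[h1 h2]; rewrite fin_numElt (lt_le_trans (ltNyr _) h1).
  by rewrite (le_lt_trans h2) ?ltry.
have hf r : (N <= r)%N -> D - A / r%:R <= fine (u r) <= D.
  by move=> hr; have := hu r hr; rewrite -{1 2}(fineK (ufin r hr)) !lee_fin.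
split.
  apply: cvg_EFin.
    by near=> r; apply: ufin; near: r; exact: nbhs_infty_ge.
  apply: (@squeeze_cvgr _ _ _ _ (fun r => D - A / r%:R) (cst D)).
  - by near=> r; apply: hf; near: r; exact: nbhs_infty_ge.
  - rewrite -[X in _ --> X]subr0 -(mulr0 A); apply: cvgB; first exact: cvg_cst.
    by apply: cvgMr; exact: cvgr_inv_natr.
  - exact: cvg_cst.
(* Adding 1 makes the constant positive even when [A = 0]. *)
apply/eqO_exP; exists (`|A| + 1); first by rewrite ltr_wpDl.
near=> r; have /hf /andP[h1 h2] : (N <= r)%N by near: r; exact: nbhs_infty_ge.
have rV0 : 0 <= r%:R^-1 :> R by rewrite invr_ge0.
rewrite ger0_norm ?subr_ge0 // (ger0_norm rV0).
have : A / r%:R <= (`|A| + 1) / r%:R.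
  by rewrite ler_wpM2r // (le_trans (ler_norm A)) // lerDl.
by apply: le_trans; rewrite lerBlDr -lerBlDl.
Unshelve. all: by end_near. Qed.

Theorem theorem4p1 (R : realType) (X Y : mmSpace R) (m n : nat)
    (x : 'I_m -> mm_space X) (y : 'I_n -> mm_space Y)
    (suppX : supported_on x) (suppY : supported_on y)
    (c : R -> R -> R) (B C : R)
    (hB : error_bound_constant m n B) (hC : simplex_constant (m * n) 2 C) :
  let a := weights x in
  let b := weights y in
  let L := GW_coeff c x y in
  let D := DGW L a b in
  let K := max_coeff L in
  let S := Num.sqrt (m * n)%:R : R in
  (forall r : nat, (4 * (m * n) <= r)%N ->
     (0 <= D%:E - GW_lb L a b r)%E /\
     (D%:E - GW_lb L a b r <=
        (C / r%:R ^+ 2 * (K - D + 3 * S * K * B)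
         + Num.sqrt C / r%:R * (3 * S * K * B))%:E)%E) /\
  (GW_lb L a b r @[r --> \oo] --> D%:E) /\
  ((fun r : nat => D - fine (GW_lb L a b r) : R^o)
     =O_\oo (fun r : nat => r%:R^-1 : R^o)).
Proof.
move=> a b L D K S.
have ha : prob_vec a := prob_vec_weights suppX.
have hb : prob_vec b := prob_vec_weights suppY.
have [m0 n0] := (prob_vec_gt0 ha, prob_vec_gt0 hb).
have mn0 : (0 < m * n)%N by rewrite muln_gt0 m0.
have lower r : (4 * (m * n) <= r)%N -> _ := GW_lb_ge ha hb L hB hC (r := r).
have upper r : (GW_lb L a b r <= D%:E)%E := GW_lb_le ha hb L r.
split=> [r hr|].
  split; first by rewrite sube_ge0 ?orbT //.
  have := lower r hr; have := upper r.
  case: (GW_lb L a b r) => [z| |] //; rewrite -?EFinB !lee_fin => _.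
  by rewrite lerBlDr -lerBlDl.
have C0 := simplex_constant_ge0 mn0 hC.
(* As [1 / r ^ 2 <= 1 / r], both error terms fit under one constant over [r]; the absolute value
   avoids a discussion of sign. *)
apply: (@rate_implies_cvg _ _ (C * `|K - D + 3 * S * K * B|
  + Num.sqrt C * (3 * S * K * B)) _ (4 * (m * n))) => r hr.
rewrite upper andbT; apply: le_trans (lower r hr); rewrite lee_fin lerD2l lerN2.
have r1 : 1 <= r%:R :> R.
  by rewrite ler1n; apply: leq_trans hr; rewrite muln_gt0.
have r0 : 0 < r%:R :> R by exact: lt_le_trans r1.
have rV1 : r%:R^-1 <= 1 :> R by rewrite invf_le1.
have rV0 : 0 <= r%:R^-1 :> R by rewrite invr_ge0 ltW.
rewrite [leRHS]mulrDl; apply: lerD; last by rewrite mulrAC.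
set Z := K - D + _; rewrite -!mulrA; apply: ler_wpM2l => //; rewrite mulrC.
apply: (@le_trans _ _ (`|Z| * r%:R ^- 2)).
  by rewrite ler_wpM2r ?invr_ge0 ?exprn_ge0 ?ler_norm // ltW.
by rewrite ler_wpM2l // -exprVn expr2 ler_piMr.
Qed.
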